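(* Consider a Borel-state MDP $(\mathbb{X},\mathbb{A},A(\cdot),c,q)$ satisfying Assumption S, and suppose there are a Borel-measurable weight function $V:\mathbb{X}\to[1,\infty)$ and constants $K\ge1$, $\bar c<\infty$ such that (a) $\|\sum_{n=0}^\infty Q_\phi^n\|_V\le K$ for all $\phi\in\mathbb{F}$; (b) $\sup_{a\in A(x)}|c(x,a)|\le\bar cV(x)$ for all $x\in\mathbb{X}$, and for every $x\in\mathbb{X}$ the mapping $a\mapsto\int_{\mathbb{X}}V(y)\,q(dy|x,a)$ is finite and continuous on $A(x)$. Let $\mu$ be a Borel-measurable function with $V\le\mu\le KV$ and $\mu(x)\ge V(x)+\int_{\mathbb{X}}\mu(y)\,q(dy|x,a)$ for all $(x,a)\in\mathrm{Gr}(A)$, let $\tilde\beta\in[\frac{K-1}{K},1)$, and let $\tilde v_{\tilde\beta}$ be the value function of the discounted MDP defined by the HV transformation. Let $v$ be the total-cost value function of the original MDP. Then: (i) $v(x)=\mu(x)\tilde v_{\tilde\beta}(x)$ for $x\in\mathbb{X}$, and $v$ is the unique Borel-measurable function satisfying the optimality equation $$v(x)=\min_{a\in A(x)}\Big[c(x,a)+\int_{\mathbb{X}}v(y)\,q(dy|x,a)\Big],\quad x\in\mathbb{X},$$ and such that $\sup_{x\in\mathbb{X}}V(x)^{-1}|v(x)|<\infty$; (ii) there is a stationary total-cost optimal policy; (iii) a policy $\phi\in\mathbb{F}$ is total-cost optimal if and only if $\phi(x)\in A^*(x)$ for all $x\in\mathbb{X}$, where $A^*(x):=\{a\in A(x):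 v(x)=c(x,a)+\int_{\mathbb{X}}v(y)\,q(dy|x,a)\}$; moreover $$A^*(x)=\Big\{a\in A(x):\ \tilde v_{\tilde\beta}(x)=\tilde c(x,a)+\tilde\beta\int_{\mathbb{X}}\tilde v_{\tilde\beta}(y)\,\tilde p(dy|x,a)\Big\},\quad x\in\mathbb{X},$$ i.e., the sets of optimal actions for the original transient MDP and for the transformed discounted MDP coincide.
   Context: Borel-state MDP: $\mathbb{X}$ and $\mathbb{A}$ are Borel subsets of complete separable metric spaces (states, actions); for each $x\in\mathbb{X}$, $A(x)$ is a nonempty Borel subset of $\mathbb{A}$; $\mathrm{Gr}(A):=\{(x,a):x\in\mathbb{X},a\in A(x)\}$ is a Borel subset of $\mathbb{X}\times\mathbb{A}$; $c:\mathrm{Gr}(A)\to\mathbb{R}$ is Borel measurable; the transition rates are given by a kernel $q$: $q(\cdot|x,a)$ is a finite measure on $\mathbb{X}$ for each $(x,a)\in\mathrm{Gr}(A)$ (not necessarily a probability), and $q(B|\cdot)$ is Borel measurable on $\mathrm{Gr}(A)$ for each Borel $B\subseteq\mathbb{X}$. A stationary policy is a Borel-measurable $\phi:\mathbb{X}\to\mathbb{A}$ with $\phi(x)\in A(x)$ for all $x$; $\mathbb{F}$ is the set of all of them. $Q_\phi u(x):=\int_{\mathbb{X}}u(y)\,q(dy|x,\phi(x))$, $Q_\phi^n$ is its $n$-th iterate (also viewed as a kernel), $c_\phi(x):=c(x,\phi(x))$. For a Borel weight function $W:\mathbb{X}\to[1,\infty)$ and a kernel $B(\cdot|\cdot)$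 on $\mathbb{X}$ given $\mathbb{X}$, $\|B\|_W:=\sup_xW(x)^{-1}\int_{\mathbb{X}}W(y)\,B(dy|x)$. Total cost: $v^\phi(x):=\sum_{n=0}^\infty Q_\phi^nc_\phi(x)$, $v(x):=\inf_{\phi\in\mathbb{F}}v^\phi(x)$; $\phi_*\in\mathbb{F}$ is total-cost optimal if $v^{\phi_*}(x)=v(x)$ for all $x$. Assumption S: (a) $A(x)$ is compact and $c(x,a)$ is lower semicontinuous in $a\in A(x)$, for each $x\in\mathbb{X}$; (b) for every $x\in\mathbb{X}$, if a sequence $\{a_n\}$ in $A(x)$ converges to $a\in A(x)$, then $q(B|x,a_n)\to q(B|x,a)$ for every Borel $B\subseteq\mathbb{X}$. HV transformation (given $V,K,\mu,\tilde\beta$ as in the claim; under Assumption S and (a) such a $\mu$ exists): state space $\tilde{\mathbb{X}}:=\mathbb{X}\cup\{\tilde x\}$ where $\tilde x\notin\mathbb{X}$ is isolated from $\mathbb{X}$, action space $\mathbb{A}\cup\{\tilde a\}$, action sets $\tilde A(x):=A(x)$ for $x\in\mathbb{X}$ and $\tilde A(\tilde x):=\{\tilde a\}$; costs $\tilde c(x,a):=\mu(x)^{-1}c(x,a)$ on $\mathrm{Gr}(A)$ and $\tilde c(\tilde x,\tilde a):=0$; transition probabilities, for $(x,a)\in\mathrm{Gr}(A)$: $\tilde p(B|x,a):=\frac1{\tilde\beta\mu(x)}\int_B\mu(y)\,q(dy|x,a)$ for Borel $B\subseteq\mathbb{X}$, $\tilde p(\{\tilde x\}|x,a):=1-\frac1{\tilde\beta\mu(x)}\int_{\mathbb{X}}\mu(y)\,q(dy|x,a)$,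 and $\tilde p(\{\tilde x\}|\tilde x,\tilde a):=1$. (If $\tilde\beta=0$, which forces $K=1$ and $q\equiv0$, quotients $0/0$ are read as $0$.) Policies are extended by $\phi(\tilde x):=\tilde a$. With $\tilde P_\phi u(x):=\int_{\tilde{\mathbb{X}}}u(y)\,\tilde p(dy|x,\phi(x))$ and $\tilde c_\phi(x):=\tilde c(x,\phi(x))$, $\tilde v^\phi_{\tilde\beta}(x):=\sum_{n=0}^\infty\tilde\beta^n\tilde P_\phi^n\tilde c_\phi(x)$ (with $0^0=1$) and $\tilde v_{\tilde\beta}(x):=\inf_{\phi\in\mathbb{F}}\tilde v^\phi_{\tilde\beta}(x)$, $x\in\tilde{\mathbb{X}}$. *)

(* Defs.v *)
From HB Require Import structures.
From mathcomp Require Import all_boot all_order all_algebra.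
From mathcomp Require Import all_classical all_reals all_analysis.
From mathcomp Require Import measurable_realfun.

Set Implicit Arguments.
Unset Strict Implicit.
Unset Printing Implicit Defensive.

Import Order.TTheory GRing.Theory Num.Theory.
Import numFieldNormedType.Exports.

Local Open Scope classical_set_scope.
Local Open Scope ring_scope.
Local Open Scope ereal_scope.

#[short(type="completeMetricType")]
HB.structure Definition CompleteMetric (R : numDomainType) :=
  {T of CompletePseudoMetric R T & PseudoMetric_isMetric R T}.

Definition separable (T : topologicalType) : Prop :=
  exists2 D : set T, countable D & dense D.

(* makes T * U a ptopologicalType when T and U are *)
HB.saturate prod.

Notation borel T := (g_sigma_algebraType (@open T)).

Definition borel_set (T : ptopologicalType) (B : set T) : Prop :=
  measurable (B : set (borel T)).

Definition borel_fun (T : ptopologicalType) d (U : measurableType d)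
  (D : set T) (f : T -> U) : Prop :=
  measurable_fun (D : set (borel T)) (f : borel T -> U).

(* The state and action spaces are Borel subsets [states] and [actions] of the
   complete metric spaces E and F.  A function on a subset is represented by a
   total function whose values outside that subset are never used, and a
   measure on [states] by a measure on E that vanishes outside [states]. *)
Record borel_mdp (R : realType) (E F : completeMetricType R) := BorelMDP {
  states : set E ;
  actions : set F ;
  act : E -> set F ;
  cost : E -> F -> R ;
  rate : E -> F -> {finite_measure set (borel E) -> \bar R} ;
  graph : set (E * F) := [set z | states z.1 /\ act z.1 z.2] ;
  borel_states : borel_set states ;
  borel_actions : borel_set actions ;
  act_sub : forall x, states x -> act x `<=` actions ;
  act_neq0 : forall x, states x -> act x !=set0 ;
  borel_act : forall x, states x -> borel_set (act x) ;
  borel_graph : borel_set graph ;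
  borel_cost : borel_fun graph (fun z : E * F => cost z.1 z.2) ;
  rate_states : forall x a, states x -> act x a -> rate x a (~` states) = 0 ;
  borel_rate : forall B, borel_set B -> B `<=` states ->
    borel_fun graph (fun z : E * F => rate z.1 z.2 B)
}.

Section total_cost.
Context (R : realType) (E F : completeMetricType R) (M : borel_mdp E F).
Implicit Types (phi : E -> F) (u : E -> \bar R) (W : E -> R).

Definition assumption_S : Prop :=
  (forall x, states M x -> compact (act M x) /\
     lower_semicontinuous
       ((fun a => (cost M x a)%:E) : subspace (act M x) -> \bar R)) /\
  (forall x, states M x ->
     forall (a_ : nat -> F) (a : F), (forall n, act M x (a_ n)) ->
       act M x a -> a_ n @[n --> \oo] --> a ->
       forall B, borel_set B -> B `<=` states M ->
         rate M x (a_ n) B @[n --> \oo] --> rate M x a B).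

Definition policies : set (E -> F) :=
  [set phi | borel_fun (states M) (phi : E -> borel F) /\
             forall x, states M x -> act M x (phi x)].

Definition Qop phi u (x : E) : \bar R :=
  \int[rate M x (phi x)]_(y in states M) u y.

(* The n-th iterate of Q_phi as a kernel: Q_phi^n(B|x) = (Q_phi^n 1_B)(x).  The
   kernels below are bare set functions, which [integral] accepts; they are
   measures under the assumptions that make the integrands measurable. *)
Definition Qker phi (n : nat) (x : E) (B : set (borel E)) : \bar R :=
  iter n (Qop phi) (fun y => (\1_B y)%:E) x.

Definition Qsum phi (x : E) (B : set (borel E)) : \bar R :=
  \sum_(0 <= n <oo) Qker phi n x B.

Definition kernel_norm W (k : E -> set (borel E) -> \bar R) : \bar R :=
  ereal_sup [set ((W x)^-1)%:E * \int[k x]_(y in states M) (W y)%:E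
            | x in states M].

Definition total_cost phi (x : E) : \bar R :=
  \sum_(0 <= n <oo) iter n (Qop phi) (fun y => (cost M y (phi y))%:E) x.

Definition value (x : E) : \bar R :=
  ereal_inf [set total_cost phi x | phi in policies].

Definition total_cost_optimal phi : Prop :=
  policies phi /\ forall x, states M x -> total_cost phi x = value x.

Definition bellman u (x : E) (a : F) : \bar R :=
  (cost M x a)%:E + \int[rate M x a]_(y in states M) u y.

Definition optimality_equation u : Prop :=
  forall x, states M x ->
    (exists2 a, act M x a & u x = bellman u x a) /\
    (forall a, act M x a -> u x <= bellman u x a).

Definition weighted_bounded W u : Prop :=
  ereal_sup [set ((W x)^-1)%:E * `|u x| | x in states M] < +oo.

Definition optimal_actions (x : E) : set F :=
  [set a | act M x a /\ value x = bellman value x a].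

End total_cost.

(* [None] is the added state: a set is open iff its trace on T is, so that
   [None] is isolated. *)
Definition isolated_open (T : topologicalType) : set (set (option T)) :=
  [set B | open (Some @^-1` B)].

Notation hv_space T := (g_sigma_algebraType (@isolated_open T)).

Section hv_transformation.
Context (R : realType) (E F : completeMetricType R) (M : borel_mdp E F).
Variables (mu : E -> R) (beta : R).
Implicit Types (phi : E -> F) (u : option E -> \bar R).

Definition hv_states : set (option E) := Some @` states M `|` [set None].

Definition hv_cost (x : option E) (a : option F) : R :=
  match x, a with
  | Some x, Some a => ((mu x)^-1 * cost M x a)%R
  | _, _ => 0%R
  end.

(* On the graph, the first summand is the part carried by the original states and
   the second one the mass at [None].  For beta = 0 the scaling factor is 0^-1 = 0, which agrees with the convention
   0/0 = 0. *)
Definition hv_kernel (x : option E) (a : option F) (B : set (hv_space E)) :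
    \bar R :=
  match x, a with
  | Some x, Some a =>
      ((beta * mu x)^-1)%:E *
        \int[rate M x a]_(y in states M `&` Some @^-1` B) (mu y)%:E +
      (1 - ((beta * mu x)^-1)%:E * \int[rate M x a]_(y in states M) (mu y)%:E)
        * (\1_B None)%:E
  | _, _ => (\1_B None)%:E
  end.

(* [omap phi] is the policy phi extended to the added state. *)
Definition hv_Pop phi u (x : option E) : \bar R :=
  \int[hv_kernel x (omap phi x)]_(y in hv_states) u y.

Definition hv_total_cost phi (x : option E) : \bar R :=
  \sum_(0 <= n <oo) (beta ^+ n)%:E *
    iter n (hv_Pop phi) (fun y => (hv_cost y (omap phi y))%:E) x.

Definition hv_value (x : option E) : \bar R :=
  ereal_inf [set hv_total_cost phi x | phi in policies M].

Definition hv_bellman u (x : option E) (a : option F) : \bar R :=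
  (hv_cost x a)%:E + beta%:E * \int[hv_kernel x a]_(y in hv_states) u y.

End hv_transformation.

(* Main.v *)
From HB Require Import structures.
Require Import Defs.
From mathcomp Require Import all_boot all_order all_algebra.
From mathcomp Require Import all_classical all_reals all_analysis.
From mathcomp Require Import measurable_realfun ring lra.

Set Implicit Arguments.
Unset Strict Implicit.
Unset Printing Implicit Defensive.

Import Order.TTheory GRing.Theory Num.Theory.
Import numFieldNormedType.Exports.

Local Open Scope classical_set_scope.

(** In the [mu]-weighted sup norm the dynamic programming operator is a
    contraction of modulus [beta], because [\int mu dq <= mu - V <= beta * mu];
    value iteration converges to a fixed point [w].  Iterating the inequality
    [w <= c_phi + Q_phi w], which is an equality for a minimizing [phi],
    identifies [w] with the value function and characterizes the optimal
    policies.  The n-th stage cost of the transformed process is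
    [(beta ^+ n * mu)^-1] times that of the original one, which relates the two
    models.

    The substantial point is the existence of Borel minimizing policies: the
    actions available at a state form a compact set, but only the graph of the
    action correspondence is known to be Borel.  A Borel set with compact
    sections has a Borel projection (Kunugui-Novikov) and a Borel
    uniformization; both are deduced from Novikov's separation theorem for
    sequences of analytic sets. *)

(** * Analytic sets and Novikov separation *)

(** The rates are continuous in the action only setwise, and among unbounded integrands only [V] has
    an integral assumed continuous; nothing is assumed of the integral of [mu] or of a candidate
    value function, which is merely Borel. Minimizing actions exist nevertheless: a function
    dominated by a multiple of [mu <= K * V] is a nonnegative function minus a multiple of [V].
    Setwise convergence makes the first integral lower semicontinuous (Fatou), and the second is
    continuous. The resulting closed sublevel sets in the compact action sets are the regularity
    that the selection uses. Separation is needed for sequences and not only for pairs because it is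
    applied to families with empty total intersection whose members may well meet, such as the
    decreasing sets of points whose section is not covered by the first members of a cover. *)

Definition cell (Z : Type) (B : nat -> nat -> set Z) (t : nat -> nat)
  (n : nat) : set Z := [set z | forall j, (j < n)%N -> B j (t j) z].

(* A countable substitute for a complete separable metric: [B k] is a closed
   cover whose interiors still cover, to be thought of as the closed balls of
   radius 2^-k centred in a dense sequence. *)
Record sieve (Z : topologicalType) (B : nat -> nat -> set Z) : Prop := Sieve {
  sieve_closed : forall k i, closed (B k i) ;
  sieve_nbhs : forall k z, exists i, nbhs (z : Z) (B k i) ;
  sieve_small : forall t (z : Z) U, (forall k, B k (t k) z) -> nbhs z U ->
    exists n, cell B t n `<=` U ;
  sieve_complete : forall t, (forall n, cell B t n !=set0) ->
    exists z, forall k, B k (t k) z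
}.

(** Closedness in the product of [Z] with the Baire space, whose basic neighbourhoods fix the first
    [n] coordinates of [s]. *)
Definition baire_closed (Z : topologicalType) (S : Z -> (nat -> nat) -> Prop) :=
  forall z s,
    (forall n U, nbhs z U -> exists z' s',
       [/\ U z', forall j, (j < n)%N -> s' j = s j & S z' s']) ->
    S z s.

(* A is the projection to Z of a closed subset of Z * N^N. *)
Definition analytic (Z : topologicalType) (A : set Z) :=
  exists2 S, baire_closed S & A = [set z | exists s, S z s].

Lemma cell_le (Z : Type) (B : nat -> nat -> set Z) t m n : (m <= n)%N ->
  cell B t n `<=` cell B t m.
Proof. by move=> mn z Bz j jm; apply: Bz; exact: leq_trans mn. Qed.

Lemma eq_cell (Z : Type) (B : nat -> nat -> set Z) t t' n :
  (forall j, (j < n)%N -> t j = t' j) -> cell B t n = cell B t' n.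
Proof.
move=> tt'; apply/seteqP; split=> z Bz j jn; move: (Bz j jn);
  by rewrite (tt' j jn).
Qed.

Section borel.
Variable Z : ptopologicalType.
Implicit Types A B : set Z.

Lemma borel_open A : open A -> borel_set A.
Proof. by move=> oA; apply: sub_gen_smallest. Qed.

Lemma borel_setC A : borel_set A -> borel_set (~` A).
Proof. exact: measurableC. Qed.

Lemma borel_setI A B : borel_set A -> borel_set B -> borel_set (A `&` B).
Proof. exact: measurableI. Qed.

Lemma borel_setU A B : borel_set A -> borel_set B -> borel_set (A `|` B).
Proof. exact: measurableU. Qed.

Lemma borel_closed A : closed A -> borel_set A.
Proof.
by move=> cA; rewrite -(setCK A); apply: borel_setC; apply: borel_open;
  exact: closed_openC.
Qed.

Lemma borel_bigcup (A : nat -> set Z) : (forall n, borel_set (A n)) ->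
  borel_set (\bigcup_n A n).
Proof. by move=> bA; exact: bigcupT_measurable. Qed.

Lemma borel_bigcap (A : nat -> set Z) : (forall n, borel_set (A n)) ->
  borel_set (\bigcap_n A n).
Proof. by move=> bA; exact: bigcapT_measurable. Qed.

Lemma borel_countable_bigcup (I : countType) (A : I -> set Z) :
  (forall i, borel_set (A i)) -> borel_set (\bigcup_i A i).
Proof.
move=> bA; rewrite (_ : \bigcup_i A i =
  \bigcup_n (if unpickle n is Some i then A i else set0)).
  by apply: borel_bigcup => n; case: unpickle => //; exact: measurable0.
apply/seteqP; split=> z [i _ Az].
  by exists (pickle i) => //; rewrite pickleK.
by move: Az; case: unpickle => // j Az; exists j.
Qed.

Lemma borel_ind (P : set Z -> Prop) :
  (forall A, open A -> P A) -> (forall A, P A -> P (~` A)) ->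
  (forall A : nat -> set Z, (forall n, P (A n)) -> P (\bigcup_n A n)) ->
  forall A, borel_set A -> P A.
Proof.
move=> Po PC PU A; apply.
split=> //; split.
- by apply: Po; exact: open0.
- by move=> B PB; rewrite setTD; exact: PC.
- exact: PU.
Qed.

End borel.

Lemma borel_preimage (Z Y : ptopologicalType) (f : Z -> Y) (A : set Y) :
  continuous f -> borel_set A -> borel_set (f @^-1` A).
Proof.
move=> cf; move: A; apply: borel_ind => [A oA|A bA|A bA].
- by apply: borel_open; exact: (open_comp (fun z _ => cf z) oA).
- by rewrite preimage_setC; exact: borel_setC.
- by rewrite preimage_bigcup; exact: borel_bigcup.
Qed.

(** Double sequences are coded by single ones through [pickle]. Agreement of two codes below [N]
    forces agreement of their [n]-th rows below [k]: row extraction is continuous on the Baire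
    space. *)
Lemma nat_pair_bound (n k : nat) : exists N, forall j, (j < k)%N ->
  (pickle (n, j) < N)%N.
Proof.
elim: k => [|k [N HN]]; first by exists 0%N.
exists (maxn N (pickle (n, k)).+1) => j; rewrite ltnS leq_eqVlt.
move=> /orP[/eqP ->|/HN jN]; first by rewrite leq_max ltnSn orbT.
by rewrite (leq_trans jN) ?leq_maxl.
Qed.

Lemma branch_choice (P : (nat -> nat) -> nat -> Prop) s0 :
  (forall s s' N, (forall j, (j < N)%N -> s j = s' j) -> P s N -> P s' N) ->
  P s0 0%N ->
  (forall s N, P s N -> exists i, P (fun j => if j == N then i else s j) N.+1)
    ->
  exists s, forall N, P s N.
Proof.
move=> Pext P0 step.
have /choice[g Hg] (p : (nat -> nat) * nat) : exists i, P p.1 p.2 ->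
    P (fun j => if j == p.2 then i else p.1 j) p.2.+1.
  have [H|H] := pselect (P p.1 p.2); last by exists 0%N.
  by have [i Hi] := step p.1 p.2 H; exists i.
pose st := fix st N := if N is M.+1 then
   (fun j => if j == M then g (st M, M) else st M j) else s0.
have Pst N : P (st N) N.
  by elim: N => //= N IH; exact: (Hg (st N, N) IH).
(* Coordinate [N] is fixed at stage [N.+1] and left alone afterwards, so the diagonal agrees with
   [st N] below [N]. *)
exists (fun N => st N.+1 N) => N; apply: Pext (Pst N) => j.
elim: N => // N IH; rewrite ltnS leq_eqVlt /=; case: eqVneq => [-> _|_ /= jN].
  by rewrite eqxx.
by rewrite IH.
Qed.

Section analytic_operations.
Variable Z : topologicalType.

Lemma analytic_closed (A : set Z) : closed A -> analytic A.
Proof.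
move=> cA; exists (fun z _ => A z); last first.
  by apply/seteqP; split=> z; [move=> Az; exists id|case].
move=> z s H; apply: cA => U Uz.
by have [z' [_ [Uz' _ Az']]] := H 0%N U Uz; exists z'.
Qed.

(** Coordinate 0 of a code names the index of a set, and the tail is a code for that set. Closedness
    survives because codes agreeing at coordinate 0 concern the same set. *)
Lemma analytic_bigcup (A : nat -> set Z) : (forall n, analytic (A n)) ->
  analytic (\bigcup_n A n).
Proof.
move=> HA.
have /choice[S HS] n : exists S, baire_closed S /\ A n = [set z | exists s,
  S z s].
  by have [S] := HA n; exists S.
exists (fun z s => S (s 0%N) z (fun j => s j.+1)).
  move=> z s H; apply: (HS (s 0%N)).1 => n U Uz.
  have [z' [s' [Uz' ss' Sz']]] := H n.+1 U Uz.
  exists z', (fun j => s' j.+1); split=> // [j jn|]; first exact: ss'.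
  by rewrite -(ss' 0%N).
apply/seteqP; split=> z.
  move=> [n _]; rewrite (HS n).2 => -[s Sz].
  by exists (fun j => if j is i.+1 then s i else n).
move=> [s Sz]; exists (s 0%N) => //; rewrite (HS _).2.
by exists (fun j => s j.+1).
Qed.

Lemma analytic_bigcap (A : nat -> set Z) : (forall n, analytic (A n)) ->
  analytic (\bigcap_n A n).
Proof.
move=> HA.
have /choice[S HS] n : exists S, baire_closed S /\ A n = [set z | exists s,
  S z s].
  by have [S] := HA n; exists S.
exists (fun z s => forall n, S n z (fun j => s (pickle (n, j)))).
  move=> z s H n; apply: (HS n).1 => k U Uz.
  have [N HN] := nat_pair_bound n k.
  have [z' [s' [Uz' ss' Sz']]] := H N U Uz.
  by exists z', (fun j => s' (pickle (n, j))); split=> // j /HN; exact: ss'.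
apply/seteqP; split=> z.
  move=> Az.
  have /choice[s Ss] n : exists s, S n z s.
    by have := Az n I; rewrite (HS n).2.
  exists (fun m => if @unpickle (nat * nat)%type m is Some p then s p.1 p.2
    else 0%N).
  move=> n; have := Ss n; congr (S n z _).
  by apply/funext => j; rewrite pickleK.
by move=> [s Ss] n _; rewrite (HS n).2; exists (fun j => s (pickle (n, j))).
Qed.

Lemma analytic_setI (A B : set Z) : analytic A -> analytic B ->
  analytic (A `&` B).
Proof.
move=> aA aB; rewrite (_ : A `&` B = \bigcap_n (if n is 0%N then A else B)).
  by apply: analytic_bigcap => -[].
apply/seteqP; split=> [z [Az Bz] []//|z H].
by split; [exact: (H 0%N)|exact: (H 1%N)].
Qed.

Lemma analytic_setU (A B : set Z) : analytic A -> analytic B ->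
  analytic (A `|` B).
Proof.
move=> aA aB; rewrite (_ : A `|` B = \bigcup_n (if n is 0%N then A else B)).
  by apply: analytic_bigcup => -[].
apply/seteqP; split=> [z [Az|Bz]|z [[|n] _ H]].
- by exists 0%N.
- by exists 1%N.
- by left.
- by right.
Qed.

End analytic_operations.

Lemma analytic_preimage (Z Y : topologicalType) (f : Z -> Y) (A : set Y) :
  continuous f -> analytic A -> analytic (f @^-1` A).
Proof.
move=> cf [S cS ->]; exists (fun z s => S (f z) s) => // z s H.
apply: cS => n U Uz; have [z' [s' [Uz' ss' Sz']]] := H n _ (cf z _ Uz).
by exists (f z'), s'.
Qed.

Section sieved.
Variables (Z : ptopologicalType) (B : nat -> nat -> set Z) (sB : sieve B).

Lemma closed_cell t n : closed (cell B t n).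
Proof.
rewrite (_ : cell B t n = \bigcap_(j in [set j | (j < n)%N]) B j (t j)) //.
by apply: closed_bigI => j _; exact: sieve_closed.
Qed.

Lemma borel_cell t n : borel_set (cell B t n).
Proof. by apply: borel_closed; exact: closed_cell. Qed.

Lemma sieve_branch (z : Z) : exists t, forall k, nbhs z (B k (t k)).
Proof.
have [t Bt] := choice (fun k => sieve_nbhs sB k z).
by exists t.
Qed.

Lemma nbhs_cell (z : Z) t n : (forall k, nbhs z (B k (t k))) ->
  nbhs z (cell B t n).
Proof.
move=> Bz; elim: n => [|n IH]; first by apply: filterS filterT => y _ j.
apply: filterS2 IH (Bz n) => y Hy By j; rewrite ltnS leq_eqVlt.
by move=> /orP[/eqP ->//|]; exact: Hy.
Qed.

Lemma cell_seq t n : cell B t n = cell B (nth 0%N (mkseq t n)) n.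
Proof. by apply: eq_cell => j jn; rewrite nth_mkseq. Qed.

Lemma nbhs_seq_cell (z : Z) U : nbhs z U ->
  exists s : seq nat, nbhs z (cell B (nth 0%N s) (size s)) /\
    cell B (nth 0%N s) (size s) `<=` U.
Proof.
move=> Uz; have [t Bt] := sieve_branch z.
have [n nU] := sieve_small sB (fun k => nbhs_singleton (Bt k)) Uz.
by exists (mkseq t n); rewrite size_mkseq -cell_seq; split=> //;
  exact: nbhs_cell.
Qed.

Lemma open_cellE U : open U ->
  U = \bigcup_(s : seq nat) (if `[< cell B (nth 0%N s) (size s) `<=` U >]
                             then cell B (nth 0%N s) (size s) else set0).
Proof.
move=> oU; apply/seteqP; split=> z.
  move=> Uz; have [s [/nbhs_singleton sz sU]] :=
    nbhs_seq_cell (open_nbhs_nbhs (conj oU Uz)).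
  by exists s => //; case: asboolP.
by move=> [s _]; case: asboolP => // sU; exact: sU.
Qed.

Lemma analytic_countable_bigcup (I : countType) (A : I -> set Z) :
  (forall i, analytic (A i)) -> analytic (\bigcup_i A i).
Proof.
move=> bA; rewrite (_ : \bigcup_i A i =
  \bigcup_n (if unpickle n is Some i then A i else set0)).
  apply: analytic_bigcup => n; case: unpickle => //.
  by apply: analytic_closed; exact: closed0.
apply/seteqP; split=> z [i _ Az].
  by exists (pickle i) => //; rewrite pickleK.
by move: Az; case: unpickle => // j Az; exists j.
Qed.

Lemma borel_analytic (A : set Z) : borel_set A -> analytic A.
Proof.
(* Complements of analytic sets need not be analytic, so the induction over Borel sets carries a set
   together with its complement. *)
suff H : borel_set A -> analytic A /\ analytic (~` A) by case/H.
move: A; apply: (@borel_ind Z) => [A oA|A []|A HA].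
- split; last by apply: analytic_closed; exact: open_closedC.
  rewrite (open_cellE oA); apply: analytic_countable_bigcup => s.
  case: ifP => _; apply: analytic_closed; last exact: closed0.
  exact: closed_cell.
- by rewrite setCK.
- rewrite setC_bigcup; split.
    by apply: analytic_bigcup => n; case: (HA n).
  by apply: analytic_bigcap => n; case: (HA n).
Qed.

(* If the sets could not be separated, codes of membership could be fixed one
   coordinate at a time while keeping the sets of points with these codes not
   separable; the limit codes determine a common point of all the [A n]. *)
Lemma novikov (A : nat -> set Z) : (forall n, analytic (A n)) ->
  \bigcap_n A n = set0 ->
  exists D : nat -> set Z, [/\ forall n, borel_set (D n),
    forall n, A n `<=` D n & \bigcap_n D n = set0].
Proof.
move=> HA A0.
have /choice[S HS] n : exists S, baire_closed S /\ A n = [set z | exists s,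
  S z s].
  by have [S] := HA n; exists S.
(* coordinate 0 carries a sieve branch of the point, coordinate n+1 a code
   of its membership in A n *)
pose T n z s := if n is m.+1 then S m z s else forall k, B k (s k) z.
pose pr (n : nat) (s : nat -> nat) (j : nat) := s (pickle (n, j)).
pose ext s N (s' : nat -> nat) := forall j : nat, (j < N)%N -> s' j = s j.
pose X s N n := [set z | exists2 s', ext s N s' & T n z (pr n s')].
pose sep s N := exists D : nat -> set Z, [/\ forall n, borel_set (D n),
  forall n, X s N n `<=` D n & \bigcap_n D n = set0].
suff [D [bD XD D0]] : sep (fun=> 0%N) 0%N.
  have full z n s : T n z s -> X (fun=> 0%N) 0%N n z.
    move=> Ts; exists (fun m =>
      if @unpickle (nat * nat)%type m is Some p then s p.2
      else 0%N) => //.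
    by congr (T n z _): Ts; apply/funext => j; rewrite /pr pickleK.
  exists (fun n => D n.+1); split=> // [n z|].
    by rewrite (HS n).2 => -[s Ss]; apply: XD; exact: (full z n.+1 s Ss).
  apply/seteqP; split=> // z Dz; rewrite -D0 => -[|n] _; last exact: Dz.
  apply: XD; have [t Bt] := sieve_branch z.
  have Tt : T 0%N z t by move=> k; exact: nbhs_singleton.
  exact: (full z 0%N t Tt).
apply: contrapT => nsep0.
have step s N : ~ sep s N -> exists i, ~ sep (fun j =>
  if j == N then i else s j) N.+1.
  move=> ns; apply: contrapT => /forallNP H; apply: ns.
  have {}H i : sep (fun j => if j == N then i else s j) N.+1 by apply:
    contrapT; exact: H.
  have /choice[D HD] := H.
  (* Coordinate [N] can only lie in the code row [n0]. Its value splits [X s N n0] into a union over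
     [i]; for any other [n] it is immaterial, and every [D i n] contains [X s N n]. Hence a union at
     [n0] and intersections elsewhere. *)
  pose n0 := if @unpickle (nat * nat)%type N is Some p then p.1 else 0%N.
  exists (fun n => if n == n0 then \bigcup_i D i n else \bigcap_i D i n); split.
  - by move=> n; case: ifP => _; [apply: borel_bigcup|apply: borel_bigcap] => i;
      case: (HD i).
  - move=> n z [s' ss' Ts'].
    case: ifPn => [_|nn0].
      exists (s' N) => //; have [_ + _] := HD (s' N); apply.
      exists s' => // j; rewrite ltnS leq_eqVlt.
      by case: eqVneq => [->//|_ /= jN]; exact: ss'.
    move=> i _; have [_ + _] := HD i; apply.
    exists (fun j => if j == N then i else s' j).
      by move=> j; rewrite ltnS leq_eqVlt; case: eqVneq => //= _ /ss'.
    congr (T n z _): Ts'; apply/funext => j; rewrite /pr.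
    case: eqVneq => // jN; move: nn0; rewrite /n0 -jN pickleK /=.
    by rewrite eqxx.
  - apply/seteqP; split=> // z Hz.
    have := Hz n0 I; rewrite eqxx => -[i _ Di].
    have [_ _ <-] := HD i => n _; have := Hz n I.
    by case: eqP => [->//|_]; exact.
have [s ns] : exists s, forall N, ~ sep s N.
  apply: (@branch_choice (fun s N => ~ sep s N)) nsep0 step => s s' N ss' ns.
  move=> [D [bD XD D0]]; apply: ns; exists D; split=> // n z [s1 ss1 Ts1].
  by apply: XD; exists s1 => // j jN; rewrite ss1 // ss'.
have cellX n N : (forall j, (j < n)%N -> (pickle (0%N, j) < N)%N) ->
    X s N 0%N `<=` cell B (pr 0%N s) n.
  by move=> HN z [s' ss' Ts'] j /HN jN; have := Ts' j; rewrite /pr ss'.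
have [z Bz] : exists z, forall k, B k (pr 0%N s k) z.
  apply: (sieve_complete sB) => n.
  have [N HN] := nat_pair_bound 0%N n.
  apply/set0P/negP => /eqP c0; apply: (ns N).
  exists (fun n => if n is 0%N then set0 else setT); split.
  - by case=> [|m]; [exact: measurable0|exact: measurableT].
  - by case=> [|m] // x /(cellX _ _ HN); rewrite c0.
  - by apply/seteqP; split=> // x /(_ 0%N I).
suff : (\bigcap_n A n) z by rewrite A0.
move=> n _; rewrite (HS n).2; exists (pr n.+1 s); apply: (HS n).1 => k U Uz.
have [m mU] := sieve_small sB Bz Uz.
have [N1 HN1] := nat_pair_bound 0%N m.
have [N2 HN2] := nat_pair_bound n.+1 k.
pose N := maxn N1 N2.
have H0 : X s N 0%N `<=` cell B (pr 0%N s) m.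
  by apply: cellX => j /HN1 jN; rewrite (leq_trans jN) ?leq_maxl.
(* By closedness of the relation coding [A n], it is enough to meet each basic neighbourhood of the
   limit. If the cell missed [X s N n.+1], the cell and its complement would separate at level
   [N]. *)
have [z' [Xz' Cz']] : X s N n.+1 `&` cell B (pr 0%N s) m !=set0.
  apply/set0P/negP => /eqP I0; apply: (ns N).
  exists (fun i => if i == 0%N then cell B (pr 0%N s) m else
                   if i == n.+1 then ~` cell B (pr 0%N s) m else setT); split.
  - move=> i; case: ifP => _; first exact: borel_cell.
    case: ifP => _; last exact: measurableT.
    by apply: borel_setC; exact: borel_cell.
  - move=> i x Xx; case: eqP Xx => [->|_]; first exact: H0.
    case: eqP => // -> Xx Cx; suff : set0 x by [].
    by rewrite -I0.
  - apply/seteqP; split=> // x Hx; have := Hx n.+1 I; rewrite eqxx /=; apply.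
    exact: (Hx 0%N I).
have [s' ss' Ts'] := Xz'.
exists z', (pr n.+1 s'); split=> //; first exact: mU.
by move=> j /HN2 jN; apply: ss'; rewrite (leq_trans jN) ?leq_maxr.
Qed.

(** Novikov's theorem for the sequence [A, C, C, ...]: a point of [C] in [D 0] would lie in every
    [D n]. *)
Lemma analytic_separation (A C : set Z) : analytic A -> analytic C ->
  A `&` C = set0 ->
  exists D, [/\ borel_set D, A `<=` D & D `&` C = set0].
Proof.
move=> aA aC AC0.
have [||D [bD AD D0]] := @novikov (fun n => if n is 0%N then A else C).
- by case.
- apply/seteqP; split=> // z Hz; rewrite -AC0; split.
    exact: (Hz 0%N).
  exact: (Hz 1%N).
exists (D 0%N); split=> //; first exact: (AD 0%N).
apply/seteqP; split=> // z [Dz Cz]; rewrite -D0 => -[|n] _ //.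
exact: (AD n.+1).
Qed.

End sieved.

(** * Borel sets with compact sections *)

(** Koenig's lemma for the tree of sequences bounded by [m]: [ok s N] keeps bounded extensions of
    the first [N] values of [s] at every height. *)
Lemma konig (m : nat -> nat) (P : (nat -> nat) -> nat -> Prop) :
  (forall t n n', (n' <= n)%N -> P t n -> P t n') ->
  (forall t t' n, (forall j, (j < n)%N -> t j = t' j) -> P t n -> P t' n) ->
  (forall n, exists2 t, forall j, (j < n)%N -> (t j <= m j)%N & P t n) ->
  exists t, forall n, P t n.
Proof.
move=> Pmono Pext Pex.
pose ok s N := forall n, exists t, [/\ forall j, (j < N)%N -> t j = s j,
  forall j, (j < n)%N -> (t j <= m j)%N & P t n].
have [s oks] : exists s, forall N, ok s N.
  apply: (@branch_choice ok (fun=> 0%N)).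
  - move=> s s' N ss' oks n; have [t [ts tm Pt]] := oks n.
    by exists t; split=> // j jN; rewrite ts // ss'.
  - by move=> n; have [t tm Pt] := Pex n; exists t.
  move=> s N oks; apply: contrapT => /forallNP H.
  have /choice[b Hb] i : exists n, ~ exists t, [/\ forall j, (j < N.+1)%N ->
      t j = if j == N then i else s j, forall j, (j < n)%N ->
        (t j <= m j)%N & P t n].
    exact/existsNP/H.
  (* Past the heights [b i] of the finitely many [i <= m N], no value of coordinate [N] can be
     continued; the [N.+1] in the maximum guarantees that [t N] is one of these values. *)
  have [t [ts tm Pt]] := oks (maxn N.+1 (\max_(i < (m N).+1) b i)).
  apply: (Hb (t N)).
  have tN : (t N < (m N).+1)%N by rewrite ltnS; apply: tm;
    rewrite leq_max ltnSn.
  have bN : (b (t N) <= maxn N.+1 (\max_(i < (m N).+1) b i))%N.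
    by rewrite leq_max (leq_bigmax (Ordinal tN)) orbT.
  exists t; split=> [j|j jb|].
  - by rewrite ltnS leq_eqVlt; case: eqVneq => [->//|_ /= /ts].
  - by apply: tm; exact: leq_trans bN.
  - exact: Pmono Pt.
exists s => n; have [t [ts _ Pt]] := oks n n.
by apply: Pext Pt => j /ts.
Qed.

Lemma borel_countable_bigcap (Z : ptopologicalType) (I : countType)
  (A : I -> set Z) :
  (forall i, borel_set (A i)) -> borel_set (\bigcap_i A i).
Proof.
move=> bA; rewrite -(setCK (\bigcap_i A i)) setC_bigcap.
apply: borel_setC; apply: borel_countable_bigcup => i; exact: borel_setC.
Qed.

Section metric_sieve.
Variables (R : realType) (E : completeMetricType R).

Lemma separable_sieve : separable E -> exists B, @sieve E B.
Proof.
move=> [D /countable_injP[g ginj] dD].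
pose d i := xget point [set x | D x /\ g x = i].
have dg x : D x -> d (g x) = x.
  move=> Dx; rewrite /d; case: xgetP => [y _ [Dy gy]|]; last by move=> /(_ x)[].
  by apply: ginj; rewrite ?inE.
(* Any radii tending to 0 would do. Closing the balls at most doubles the radius, so two points of
   [B k i] are within [4 * e k]. *)
pose e (k : nat) : R := (k.+1%:R^-1)%R.
have e0 k : (0 < e k)%R by rewrite /e invr_gt0 ltr0n.
pose B k i := closure (ball (d i) (e k)).
have Bball k i y : B k i y -> ball (d i) (e k + e k)%R y.
  move=> /(_ _ (nbhsx_ballx y _ (e0 k)))[w [dw yw]].
  by apply: ball_triangle dw _; exact: ball_sym.
have B2 k i y z : B k i y -> B k i z -> ball y (4 * e k)%R z.
  move=> /Bball/ball_sym yB /Bball zB.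
  have := ball_triangle yB zB.
  by congr (ball y _ z); rewrite -!mulr2n -mulrnA mulr_natl.
have e_small (r : R) c : (0 < r)%R -> (0 < c)%R -> exists k, (c * e k < r)%R.
  move=> r0 c0.
  exists (Num.truncn (c / r)%R); rewrite /e.
  rewrite ltr_pdivrMr ?ltr0n // mulrC -ltr_pdivrMr //.
  exact: truncnS_gt.
exists B; split.
- by move=> k i; exact: closed_closure.
- move=> k z.
  have he : (0 < e k / 2)%R by rewrite divr_gt0.
  have [x [zx Dx]] : (ball z (e k / 2)%R)^° `&` D !=set0.
    apply: dD; last exact: open_interior.
    by exists z; exact: nbhsx_ballx.
  exists (g x); apply: filterS (nbhsx_ballx z _ he) => w zw.
  apply: subset_closure; rewrite dg // (splitr (e k)); apply: ball_triangle zw.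
  by apply: ball_sym; exact: interior_subset zx.
- move=> t z U Bz /nbhs_ballP[r /= r0 rU].
  have [k kr] := e_small r 4%R r0 (ltr0n _ 4).
  exists k.+1 => y /(_ k (ltnSn k)) By; apply: rU.
  exact: le_ball (ltW kr) _ (B2 _ _ _ _ (Bz k) By).
(* Points picked from the cells stay in [B k (t k)] from rank [k.+1] on. These sets shrink, so the
   points form a Cauchy sequence whose limit remains in the closed sets. *)
- move=> t Bt; have /choice[x Bx] := Bt.
  have xB k n : (k < n)%N -> B k (t k) (x n) by move=> kn; exact: Bx.
  have /cauchy_cvgP xcvg : cauchy (x @ \oo).
    apply: cauchy_exP => r r0.
    have [k kr] := e_small r 4%R r0 (ltr0n _ 4).
    exists (x k.+1); exists k.+1 => // n /= kn.
    apply: le_ball (ltW kr) _ (B2 k (t k) _ _ _ _); exact: xB.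
  exists (lim (x @ \oo)) => k.
  apply: (closed_cvg _ _ _ _ xcvg); first exact: closed_closure.
  by exists k.+1 => // n /= kn; exact: xB.
Qed.

End metric_sieve.

(** * Product sieves and projections of analytic sets *)

Section product.
Variables (X Y : ptopologicalType).

Let dec (i : nat) : nat * nat := odflt (0%N, 0%N) (unpickle i).

Definition prod_sieve (BX : nat -> nat -> set X) (BY : nat -> nat -> set Y)
  k i :
  set (X * Y) := BX k (dec i).1 `*` BY k (dec i).2.

Lemma cell_prod BX BY t n : cell (prod_sieve BX BY) t n =
  cell BX (fun j => (dec (t j)).1) n `*` cell BY (fun j => (dec (t j)).2) n.
Proof.
apply/seteqP; split=> -[x y] /=.
  by move=> H; split=> j /H[].
by move=> [Hx Hy] j jn; split; [exact: Hx|exact: Hy].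
Qed.

Lemma sieve_prod BX BY : sieve BX -> sieve BY -> sieve (prod_sieve BX BY).
Proof.
move=> sX sY; split.
- move=> k i; rewrite /prod_sieve.
  rewrite (_ : _ `*` _ = fst @^-1` (BX k (dec i).1)
    `&` snd @^-1` (BY k (dec i).2)) //.
  apply: closedI; apply: closed_comp => [z _|];
    [exact: cvg_fst|exact: sieve_closed
    |exact: cvg_snd|exact: sieve_closed].
- move=> k [x y]; have [i Bi] := sieve_nbhs sX k x;
    have [j Bj] := sieve_nbhs sY k y.
  by exists (pickle (i, j)); rewrite /prod_sieve /dec pickleK;
    exists (BX k i, BY k j).
- move=> t [x y] U Bz [[U1 U2] /= [xU yU] UU].
  have [n nU] := sieve_small sX (fun k => (Bz k).1) xU.
  have [m mU] := sieve_small sY (fun k => (Bz k).2) yU.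
  exists (maxn n m); rewrite cell_prod => -[x' y'] /= [Hx Hy]; apply: UU; split.
    by apply: nU; apply: cell_le Hx; exact: leq_maxl.
  by apply: mU; apply: cell_le Hy; exact: leq_maxr.
- move=> t Ht.
  have [x Bx] : exists x, forall k, BX k (dec (t k)).1 x.
    apply: (sieve_complete sX) => n; have [[x y]] := Ht n.
    by rewrite cell_prod => -[/= Hx _]; exists x.
  have [y By] : exists y, forall k, BY k (dec (t k)).2 y.
    apply: (sieve_complete sY) => n; have [[x' y]] := Ht n.
    by rewrite cell_prod => -[/= _ Hy]; exists y.
  by exists (x, y).
Qed.

(** A point [y] is replaced by a branch of the sieve through it, so projecting along [Y] becomes
    projecting along the Baire space. Completeness of the sieve supplies [y] for a limit code. *)
Lemma analytic_fst (BY : nat -> nat -> set Y) (A : set (X * Y)) :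
  sieve BY -> analytic A -> analytic (fst @` A).
Proof.
move=> sY [S cS ->].
pose pr (i : nat) (s : nat -> nat) (j : nat) := s (pickle (i, j)).
exists (fun x s => exists2 y, forall k, BY k (pr 0%N s k) y & S (x, y)
  (pr 1%N s)).
  move=> x s H.
  have [y By] : exists y, forall k, BY k (pr 0%N s k) y.
    apply: (sieve_complete sY) => n; have [N HN] := nat_pair_bound 0%N n.
    have [x' [s' [_ ss' [y By _]]]] := H N setT filterT.
    by exists y => j jn; have := By j; rewrite /pr ss' //; exact: HN.
  exists y => //; apply: cS => n U [[U1 U2] /= [xU yU] UU].
  have [m mU] := sieve_small sY By yU.
  have [N1 HN1] := nat_pair_bound 0%N m.
  have [N2 HN2] := nat_pair_bound 1%N n.
  have [x' [s' [Ux' ss' [y' By' Sxy']]]] := H (maxn N1 N2) U1 xU.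
  exists (x', y'), (pr 1%N s'); split=> //.
    apply: UU; split=> //; apply: mU => j jm; have := By' j; rewrite /pr ss' //.
    by rewrite (leq_trans (HN1 _ jm)) ?leq_maxl.
  by move=> j jn; apply: ss'; rewrite (leq_trans (HN2 _ jn)) ?leq_maxr.
apply/seteqP; split=> x.
  move=> [[x' y] [s Ss] /= <-].
  have [t Bt] := sieve_branch sY y.
  exists (fun m => if @unpickle (nat * nat)%type m is Some p then
    (if p.1 == 0%N then t p.2 else s p.2) else 0%N); exists y.
    by move=> k; rewrite /pr pickleK /=; exact: nbhs_singleton.
  congr (S (x', y) _): Ss; apply/funext => j; by rewrite /pr pickleK.
by move=> [s [y By Sy]]; exists (x, y) => //; exists (pr 1%N s).
Qed.

End product.

Section compact_sections.
Variables (X Y : ptopologicalType).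
Variables (BX : nat -> nat -> set X) (BY : nat -> nat -> set Y).
Hypotheses (sX : sieve BX) (sY : sieve BY) (hY : hausdorff_space Y).

Let sXY : sieve (prod_sieve BX BY) := sieve_prod sX sY.

Definition compact_sections (G : set (X * Y)) :=
  forall x, compact [set y | G (x, y)].

Lemma borel_fst (A : set X) : borel_set A ->
  borel_set ((fst : X * Y -> X) @^-1` A).
Proof. by apply: borel_preimage => z; exact: cvg_fst. Qed.

Lemma borel_snd (A : set Y) : borel_set A ->
  borel_set ((snd : X * Y -> Y) @^-1` A).
Proof. by apply: borel_preimage => z; exact: cvg_snd. Qed.

Lemma analytic_proj (G : set (X * Y)) : borel_set G ->
  analytic ((fst : X * Y -> X) @` G).
Proof. by move=> bG; apply: (analytic_fst sY); exact: (borel_analytic sXY). Qed.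

Lemma sieve_base : exists U : nat -> set Y, (forall n, open (U n)) /\
  (forall y V, nbhs y V -> exists n, U n y /\ U n `<=` V).
Proof.
exists (fun n => if @unpickle (seq nat) n is Some s
  then (cell BY (nth 0%N s) (size s))° else set0); split.
  by move=> n; case: unpickle => [s|]; [exact: open_interior|exact: open0].
move=> y V /(nbhs_seq_cell sY)[s [sy sV]].
exists (pickle s); rewrite pickleK; split=> //.
by apply: subset_trans sV; exact: interior_subset.
Qed.

(* A form of the Kunugui-Novikov theorem: the complement of [G], whose sections
   are open, is a countable union of Borel rectangles [C n `*` U n]. *)
Lemma kunugui_novikov (G : set (X * Y)) (U : nat -> set Y) :
  borel_set G -> (forall x, closed [set y | G (x, y)]) ->
  (forall n, open (U n)) ->
  (forall y V, nbhs y V -> exists n, U n y /\ U n `<=` V) ->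
  exists C : nat -> set X, [/\ forall n, borel_set (C n),
    forall x y, ~ G (x, y) -> exists n, C n x /\ U n y &
    forall n x y, C n x -> U n y -> ~ G (x, y)].
Proof.
move=> bG cG oU Ubase.
(* [Q n] holds the [x] whose section meets [U n]. Sections are closed, so around a point outside [G]
   some [U n] misses the section; hence no point lies in all the [A n]. *)
pose Q n := fst @` (G `&` snd @^-1` U n).
have aQ n : analytic (Q n).
  by apply: analytic_proj; apply: borel_setI => //; apply: borel_snd;
    exact: borel_open.
pose A n := ~` G `&` (fst @^-1` Q n `|` snd @^-1` (~` U n)).
have [||D [bD AD D0]] := @novikov _ _ sXY A.
- move=> n; apply: analytic_setI.
    by apply: (borel_analytic sXY); exact: borel_setC.
  apply: analytic_setU.
    by apply: analytic_preimage => // z; exact: cvg_fst.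
  apply: (borel_analytic sXY); apply: borel_snd; apply: borel_setC.
  exact: borel_open.
- apply/seteqP; split=> // -[x y] H.
  have [nG _] := H 0%N I.
  have [n [Uy UG]] : exists n, U n y /\ U n `<=` ~` [set y | G (x, y)].
    by apply: Ubase; apply: open_nbhs_nbhs; split=> //; exact: closed_openC.
  have [_ [[[x' y'] [/= Gy' Uy']] /= xx'|]] := H n I; last by [].
  by apply: (UG y') => //=; rewrite -xx'.
pose P n := fst @` (~` G `&` ~` D n).
have aP n : analytic (P n).
  by apply: analytic_proj; apply: borel_setI; exact: borel_setC.
have PU n x y : ~ G (x, y) -> ~ D n (x, y) -> ~ Q n x /\ U n y.
  move=> nG nD; split; first by move=> Qx; apply/nD/AD; split=> //; left.
  by apply: contrapT => nU; apply/nD/AD; split=> //; right.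
(* The inclusion of [P n] makes the rectangles cover the complement of [G]; disjointness from [Q n]
   keeps them off [G]. *)
have /choice[C HC] n : exists C, [/\ borel_set C,
  P n `<=` C & C `&` Q n = set0].
  apply: (analytic_separation sX) => //; apply/seteqP; split=> // x.
  by move=> [[[x' y] [/= nG nD] /= <-] Qx]; have [] := PU n x' y nG nD.
exists C; split.
- by move=> n; case: (HC n).
- move=> x y nG.
  have [n nD] : exists n, ~ D n (x, y).
    apply: contrapT => /forallNP H; suff : (\bigcap_n D n) (x, y) by rewrite D0.
    by move=> n _; apply: contrapT; exact: H.
  have [_ Uy] := PU n x y nG nD.
  by exists n; split=> //; have [_ + _] := HC n; apply; exists (x, y).
- move=> n x y Cx Uy Gxy; have [_ _ CQ] := HC n.
  by suff : set0 x by []; rewrite -CQ; split=> //; exists (x, y).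
Qed.

Lemma compact_sectionsI (G H : set (X * Y)) : compact_sections G ->
  (forall x, closed [set y | H (x, y)]) -> compact_sections (G `&` H).
Proof. by move=> cG cH x; exact: compact_closedI (cG x) (cH x). Qed.

(* A point [x] is outside the projection iff for some [n] every intersection of
   one set from each of the first [n] covers, among those that can meet the
   section at [x], lies in a single [U i] with [C i x]; the existence of [n] is
   Koenig's lemma, and the condition is Borel in [x]. *)
Lemma borel_proj_compact (G : set (X * Y)) : borel_set G ->
  compact_sections G -> borel_set ((fst : X * Y -> X) @` G).
Proof.
move=> bG kG.
have cG x : closed [set y | G (x, y)] by exact: compact_closed.
have [U [oU Ubase]] := sieve_base.
have [C [bC CU CG]] := kunugui_novikov bG cG oU Ubase.
(* [M k m] bounds from outside the x whose section is not covered by the first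
   m+1 sets of the k-th cover *)
pose T k m := fst @` (G `&` snd @^-1` \bigcap_(i in [set i | (i <= m)%N])
  ~` BY k i).
have /choice[M HM] k : exists M : nat -> set X, [/\ forall m, borel_set (M m),
    forall m, T k m `<=` M m & \bigcap_m M m = set0].
  apply: (novikov sX) => [m|].
    apply: analytic_proj; apply: borel_setI => //; apply: borel_snd.
    rewrite bigcap_mkcond; apply: borel_bigcap => i; case: ifP => _.
      by apply: borel_setC; apply: borel_closed; exact: sieve_closed.
    exact: measurableT.
  apply/seteqP; split=> // x Hx.
  have /compact_near_coveringP kx := kG x.
  (* The interiors of the cover members already cover the compact section, so the indices needed are
     bounded. *)
  have [|N _ HN] := kx nat \oo (fun m y => exists2 i, (i <= m)%N & BY k i y) _.
    move=> y Gy; have [i Bi] := sieve_nbhs sY k y.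
    exists (BY k i, [set m | (i <= m)%N]) => /=; first by split=> //; exists i.
    by move=> [y' m] /= [By' im]; exists i.
  have [[x' y] [Gxy /= Hy] /= xx'] := Hx N I; subst x'.
  by have [i iN By] := HN N (leqnn N) y Gxy; exact: (Hy i).
(* For [x] in [cov n t] the cell misses the section at [x], as witnessed by a single Borel
   rectangle. *)
pose cov (n : nat) (t : nat -> nat) : set X :=
  \bigcup_i (if `[< cell BY t n `<=` U i >] then C i else set0).
suff -> : fst @` G = ~` \bigcup_(s : seq nat)
   ((\bigcap_j (if (j < size s)%N then ~` M j (nth 0%N s j) else setT)) `&`
    \bigcap_(t : seq nat) (if all (fun j => (nth 0 t j <= nth 0 s j)%N)
      (iota 0 (size s))
      then cov (size s) (nth 0%N t) else setT)).
  apply: borel_setC; apply: borel_countable_bigcup => s; apply: borel_setI.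
    apply: borel_bigcap => j; case: ifP => _; last exact: measurableT.
    by apply: borel_setC; case: (HM j).
  apply: borel_countable_bigcap => t; case: ifP => _; last exact: measurableT.
  by apply: borel_bigcup => i; case: ifP => _ //; exact: measurable0.
rewrite -[LHS]setCK; congr (~` _); apply/seteqP; split=> x.
  move=> nx.
  have nG y : ~ G (x, y) by move=> Gy; apply: nx; exists (x, y).
  have /choice[m Hm] j : exists m, ~ M j m x.
    apply: contrapT => /forallNP H; have [_ _ M0] := HM j.
    suff : (\bigcap_m M j m) x by rewrite M0.
    by move=> m _; apply: contrapT; exact: H.
  suff [n Hn] : exists n, forall t, (forall j, (j < n)%N -> (t j <= m j)%N) ->
      cov n t x.
    exists (mkseq m n) => //; rewrite size_mkseq; split=> [j _|t _].
      by case: ifP => // jn; rewrite nth_mkseq //; exact: Hm.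
    case: ifP => // /allP tm; apply: Hn => j jn.
    by have := tm j; rewrite mem_iota nth_mkseq //; exact.
  apply: contrapT => /forallNP Hn.
  (* If no height works, an infinite branch of uncovered cells closes down on a point [y] outside
     the section; the rectangle around [(x, y)] then covers a cell of this very branch. *)
  have [||n|t Ht] := @konig m (fun t n => ~ cov n t x).
  - move=> t n n' nn' H [i _]; case: asboolP => // ti Ci; apply: H.
    exists i => //; case: asboolP => // -[]; apply: subset_trans ti.
    exact: cell_le.
  - move=> t t' n tt'; rewrite /cov.
    by rewrite (eq_cell _ tt').
  - have /existsNP[t /not_implyP[tm ntc]] := Hn n.
    by exists t.
  have [y By] : exists y, forall k, BY k (t k) y.
    apply: (sieve_complete sY) => n; apply/set0P/negP => /eqP c0.
    have [i [Ci _]] := CU x point (nG point).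
    apply: (Ht n); exists i => //; case: asboolP => // -[]; rewrite c0.
    exact: sub0set.
  have [i [Ci Ui]] := CU x y (nG y).
  have [n nU] := sieve_small sY By (open_nbhs_nbhs (conj (oU i) Ui)).
  by apply: (Ht n); exists i => //; case: asboolP.
move=> [s _ [sM sC]] [[x' y] Gxy /= xx']; subst x'.
(* Since [x] avoids the sets [M j], the point [y] lies in a cell whose indices respect the bounds
   [s]; a rectangle over [x] containing that cell would exclude [(x, y)] from [G]. *)
have /choice[t Ht] j : exists i, (j < size s)%N -> (i <= nth 0 s j)%N /\
  BY j i y.
  case: (ltnP j (size s)) => js; last by exists 0%N.
  apply: contrapT => /forallNP H.
  have := sM j I; rewrite js; apply; have [_ + _] := HM j; apply.
  exists (x, y) => //; split=> // i /= im Bi; apply: (H i) => _; split=> //.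
have := sC (mkseq t (size s)) I; case: ifP => [_ [i _]|/negP[]].
  case: asboolP => // tU Ci; apply: (CG i x y Ci _ Gxy); apply: tU => j js.
  by rewrite nth_mkseq //; exact: (Ht j js).2.
by apply/allP => j; rewrite mem_iota /= => js; rewrite nth_mkseq //;
  exact: (Ht j js).1.
Qed.

(** [H i] is Borel by the projection theorem, so the first index whose cover member meets the
    section depends on [x] in a Borel way; the disjoint sets [L i] sort the points by this index. *)
Lemma shrink_sections n (G : set (X * Y)) : borel_set G -> compact_sections G ->
  exists G', [/\ borel_set G', compact_sections G', G' `<=` G,
    fst @` G' = fst @` G &
    forall x, exists i, forall y, G' (x, y) -> BY n i y].
Proof.
move=> bG kG.
pose H i := (fst : X * Y -> X) @` (G `&` snd @^-1` BY n i).
have cB i (x : X) : closed [set y | ((snd : X * Y -> Y) @^-1` BY n i) (x, y)].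
  exact: sieve_closed.
have bB i : borel_set ((snd : X * Y -> Y) @^-1` BY n i).
  by apply: borel_snd; apply: borel_closed; exact: sieve_closed.
have bH i : borel_set (H i).
  apply: borel_proj_compact; first exact: borel_setI.
  exact: compact_sectionsI.
pose L i := H i `&` \bigcap_(j in [set j | (j < i)%N]) ~` H j.
have bL i : borel_set (L i).
  apply: borel_setI => //; rewrite bigcap_mkcond; apply: borel_bigcap => j.
  by case: ifP => _; [apply: borel_setC; exact: bH|exact: measurableT].
have Luniq x i j : L i x -> L j x -> i = j.
  move=> [Hi Li] [Hj Lj]; case: (ltngtP i j) => // ij.
    by have := Lj i ij.
  by have := Li j ij.
have Lex x y : G (x, y) -> exists2 i, L i x & H i x.
  move=> Gxy; have [i0 Bi0] := sieve_nbhs sY n y.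
  have ex : exists i, `[< H i x >].
    by exists i0; apply/asboolP; exists (x, y) => //; split=> //;
      exact: (nbhs_singleton Bi0).
  case: (ex_minnP ex) => i /asboolP Hi mini; exists i => //; split=> // j /= ji.
  by move=> /asboolP /mini; rewrite leqNgt ji.
pose G' := \bigcup_i (G `&` (fst @^-1` L i) `&` snd @^-1` BY n i).
have G'E x i : L i x -> [set y | G' (x, y)] = [set y | (G `&` snd @^-1` BY n i)
  (x, y)].
  move=> Lx; apply/seteqP; split=> y.
    by move=> [j _ [[Gxy Lj] Bj]]; rewrite (Luniq x i j).
  by move=> [Gxy Bi]; exists i.
exists G'; split.
- apply: borel_bigcup => i; apply: borel_setI => //.
  by apply: borel_setI => //; exact: borel_fst.
- move=> x; have [[i Lx]|nL] := pselect (exists i, L i x).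
    by rewrite (G'E x i Lx); exact: compact_sectionsI.
  rewrite (_ : [set y | _] = set0); first exact: compact0.
  by apply/seteqP; split=> // y [i _ [[_ Li] _]]; apply: nL; exists i.
- by move=> z [i _ [[]]].
- apply/seteqP; split=> x.
    by move=> [z [i _ [[Gz _] _]] <-]; exists z.
  move=> [[x' y] Gxy /= <-].
  have [i Li [[x1 y1] [/= G1 B1] /= xx1]] := Lex x' y Gxy; subst x1.
  by exists (x', y1) => //; exists i.
- move=> x; have [[i Lx]|nL] := pselect (exists i, L i x).
    by exists i => y [j _ [[_ Lj]]]; rewrite (Luniq x i j).
  by exists 0%N => y [i _ [[_ Li] _]]; case: nL; exists i.
Qed.

(* Cutting the sections successively with the first member of the n-th cover
   that they meet shrinks them to points. *)
Lemma borel_uniformization (G : set (X * Y)) : borel_set G ->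
  compact_sections G ->
  exists f : X -> Y, (forall x y, G (x, y) -> G (x, f x)) /\
    forall C, closed C ->
      borel_set ((fst : X * Y -> X) @` G `&` f @^-1` C).
Proof.
move=> bG kG.
have /choice[g Hg] (p : nat * set (X * Y)) : exists G',
    borel_set p.2 -> compact_sections p.2 ->
    [/\ borel_set G', compact_sections G', G' `<=` p.2,
      (fst : X * Y -> X) @` G' = fst @` p.2 &
      forall x, exists i, forall y, G' (x, y) -> BY p.1 i y].
  have [b|nb] := pselect (borel_set p.2); last by exists set0.
  have [c|nc] := pselect (compact_sections p.2); last by exists set0.
  by have [G' HG'] := shrink_sections p.1 b c; exists G'.
pose Gn := fix Gn n := if n is m.+1 then g (m, Gn m) else G.
have Gnbk n : borel_set (Gn n) /\ compact_sections (Gn n).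
  elim: n => //= n [b c]; by have [] := Hg (n, Gn n) b c.
have GnS n : [/\ Gn n.+1 `<=` Gn n, (fst : X * Y -> X)
  @` Gn n.+1 = fst @` Gn n &
    forall x, exists i, forall y, Gn n.+1 (x, y) -> BY n i y].
  by have [b c] := Gnbk n; have [] := Hg (n, Gn n) b c.
have Gn_le m n : (m <= n)%N -> Gn n `<=` Gn m.
  move=> /subnK <-; elim: (n - m)%N => //= k IH.
  by have [+ _ _] := GnS (k + m)%N; move/subset_trans; apply.
have GnE n : (fst : X * Y -> X) @` Gn n = fst @` G.
  by elim: n => // n IH; have [_ -> _] := GnS n.
have Gninh x y n : G (x, y) -> exists y', Gn n (x, y').
  move=> Gxy; have : (fst @` G) x by exists (x, y).
  by rewrite -(GnE n) => -[[x' y'] H /= <-]; exists y'.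
pose Gi := \bigcap_n Gn n.
have key x : exists t, forall n y, Gn n (x, y) -> cell BY t n y.
  have /choice[t Ht] n : exists i, forall y, Gn n.+1 (x, y) -> BY n i y.
    by have [_ _] := GnS n; exact.
  by exists t => n y Gy j jn; apply: Ht; exact: Gn_le Gy.
(* The nested sections lie in the cells of one branch, which shrink to a point. This point belongs
   to each closed section because all its neighbourhoods contain a later one. *)
have ex x y : G (x, y) -> exists y', Gi (x, y').
  move=> Gxy; have [t Ht] := key x.
  have [y' By'] : exists y, forall k, BY k (t k) y.
    apply: (sieve_complete sY) => n; have [y' /Ht] := Gninh x y n Gxy.
    by exists y'.
  exists y' => n _; apply: contrapT => nG.
  have cn : closed [set y | Gn n (x, y)].
    by apply: compact_closed => //; case: (Gnbk n).
  have [m mU] := sieve_small sY By' (open_nbhs_nbhs (conj (closed_openC cn)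
    nG)).
  have [y1 Gy1] := Gninh x y (maxn n m) Gxy.
  apply: (mU y1); last by apply: Gn_le Gy1; exact: leq_maxl.
  by apply: cell_le (Ht _ _ Gy1); exact: leq_maxr.
have uniq x y y' : Gi (x, y) -> Gi (x, y') -> y = y'.
  move=> Gy Gy'; apply: contrapT => nyy'; have [t Ht] := key x.
  have By k : BY k (t k) y by apply: (Ht k.+1 y (Gy _ I)).
  have : nbhs y (~` [set y']).
    apply: open_nbhs_nbhs; split=> //; apply: closed_openC.
    exact/accessible_closed_set1/hausdorff_accessible.
  by move=> /(sieve_small sY By)[n] /(_ y' (Ht n y' (Gy' n I))); apply.
have /choice[f Hf] x : exists y, (exists y', G (x, y')) -> Gi (x, y).
  have [[y /ex[y' Gy']]|n] := pselect (exists y, G (x, y)); first by exists y'.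
  by exists point.
have bGi : borel_set Gi by apply: borel_bigcap => n; case: (Gnbk n).
exists f; split=> [x y Gxy|C cC].
  by apply: (Hf x _ 0%N I); exists y.
(* [Gi] is the graph of [f] over the projection, so the preimage of [C] is itself the projection of
   a Borel set with compact sections. *)
rewrite (_ : _ `&` _ = fst @` (Gi `&` snd @^-1` C)).
  apply: borel_proj_compact.
    by apply: borel_setI => //; apply: borel_snd; exact: borel_closed.
  apply: compact_sectionsI => // x.
  rewrite (_ : [set y | Gi (x, y)] = \bigcap_n [set y | Gn n (x, y)]).
    apply: (subclosed_compact _ (kG x)); last by move=> y /(_ 0%N I).
    by apply: closed_bigI => n _; apply: compact_closed => //; case: (Gnbk n).
  by apply/seteqP; split=> y H n _; exact: H.
apply/seteqP; split=> x.
  move=> [[[x' y] Gxy /= xx'] Cf]; subst x'.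
  exists (x, f x) => //; split=> //; apply: Hf; by exists y.
move=> [[x' y] [/= Gy Cy] /= xx']; subst x'.
have Gxy : G (x, y) by exact: (Gy 0%N I).
split; first by exists (x, y).
by rewrite /= (uniq x (f x) y) //; apply: Hf; exists y.
Qed.

End compact_sections.
Local Open Scope ring_scope.

(** Borel sets of the product are generated by its open sets. Countable bases write an open set as a
    countable union of open rectangles, whose preimages under the pairing are Borel. *)
Lemma borel_fun_pair (X Y : ptopologicalType) (BX : nat -> nat -> set X)
    (BY : nat -> nat -> set Y) (D : set X) (phi : X -> Y) :
  sieve BX -> sieve BY -> borel_set D -> borel_fun D (phi : X -> borel Y) ->
  borel_fun D ((fun x => (x, phi x)) : X -> borel (X * Y)%type).
Proof.
move=> sX sY bD mphi.
have [U [oU Ubase]] := sieve_base sX.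
have [V [oV Vbase]] := sieve_base sY.
apply: (@measurability _ _ (borel X) (borel (X * Y)%type)
  D _ (@open (X * Y)%type)) => //.
move=> _ [W oW <-].
rewrite (_ : D `&` _ = \bigcup_n \bigcup_m
  (if `[< U n `*` V m `<=` W >] then U n `&` (D `&` phi @^-1` V m) else set0)).
  apply: borel_bigcup => n; apply: borel_bigcup => m; case: ifP => _;
    last exact: measurable0.
  apply: borel_setI; first exact: borel_open.
  by apply: mphi => //; exact: borel_open.
apply/seteqP; split=> x.
  move=> [Dx /= Wx]; have [[P Q] /= [Px Qx] PQ] := open_nbhs_nbhs (conj oW Wx).
  have [n [Ux UP]] := Ubase x P Px; have [m [Vx VQ]] := Vbase _ _ Qx.
  exists n => //; exists m => //; case: asboolP => // -[] [y z] /= [Uy Vz].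
  by apply: PQ; split; [exact: UP|exact: VQ].
move=> [n _ [m _]]; case: asboolP => // UW [Ux [Dx Vx]]; split=> //.
exact: (UW (x, phi x)).
Qed.

(** A minimizing sequence has a cluster point. If its value exceeded the infimum, a closed sublevel
    set at a level in between would contain a tail of the sequence but not the point. *)
Lemma compact_attains_min (R : realType) (T : topologicalType) (K : set T)
    (g : T -> R) (b : R) : compact K -> K !=set0 ->
  (forall r, closed [set a | K a /\ g a <= r]) ->
  (forall a, K a -> b <= g a) ->
  exists2 a, K a & forall a', K a' -> g a <= g a'.
Proof.
move=> kK [a0 Ka0] cg gb.
pose m := inf [set g a | a in K].
have hm : has_inf [set g a | a in K].
  by split; [exists (g a0); exists a0|exists b => _ [a Ka <-]; exact: gb].
have /choice[s Hs] n : exists a, K a /\ g a < m + n.+1%:R^-1.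
  have n0 : 0 < n.+1%:R^-1 :> R by rewrite invr_gt0 ltr0n.
  by have [_ [a Ka <-] am] := inf_adherent n0 hm; exists a.
have [|a [Ka aF]] := kK (s @ \oo) _.
  by exists 0%N => // n _; exact: (Hs n).1.
exists a => // a' Ka'; rewrite leNgt; apply/negP => a'a.
have ma : m < g a by apply: le_lt_trans a'a; apply: ge_inf;
  [case: hm|exists a'].
have [k kma] : exists k : nat, k.+1%:R^-1 < g a - m.
  exists (Num.truncn ((g a - m)^-1)).
  by rewrite invf_plt ?posrE ?ltr0n ?subr_gt0 // truncnS_gt.
have [] := aF [set a | K a /\ g a < m + k.+1%:R^-1] (~` [set a | K a /\
  g a <= m + k.+1%:R^-1]).
- exists k => // n /= kn; split; first exact: (Hs n).1.
  apply: lt_le_trans (Hs n).2 _; rewrite lerD2l lef_pV2 ?posrE ?ltr0n //.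
  by rewrite ler_nat.
- apply: open_nbhs_nbhs; split; first exact: closed_openC.
  by move=> [_]; rewrite leNgt => /negP; apply; rewrite addrC -ltrBrDr.
- by move=> a1 [[Ka1 ga1] []]; split=> //; exact: ltW.
Qed.

(** * Measurable selection of minimizers *)

Section selection.
Context (R : realType) (E F : completeMetricType R) (M : borel_mdp E F).
Hypotheses (sepE : separable E) (sepF : separable F).
Hypothesis compact_act : forall x, states M x -> compact (act M x).

Lemma act_closed x : states M x -> closed (act M x).
Proof. by move=> /compact_act; apply: compact_closed;
  exact: metric_hausdorff. Qed.

Lemma borel_fun_policy d (U : measurableType d) (g : E -> F -> U) phi :
  borel_fun (graph M) (fun z : E * F => g z.1 z.2) -> policies M phi ->
  borel_fun (states M) (fun x => g x (phi x)).
Proof.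
move=> mg [mphi aphi]; have [BE sE] := separable_sieve sepE.
have [BF sF] := separable_sieve sepF.
have mpair := borel_fun_pair sE sF (borel_states M) mphi.
apply: (measurable_comp _ _ mg mpair); first exact: borel_graph.
by move=> _ [x Sx <-]; split=> //; exact: aphi.
Qed.

(** Comparison with rational levels suffices, and each sublevel set has compact sections, hence a
    Borel projection; so the set of minimizing pairs is Borel. Its sections over the states are
    compact and nonempty, and uniformization yields a policy. *)
Lemma measurable_minimizer (g : E -> F -> R) :
  borel_fun (graph M) (fun z : E * F => g z.1 z.2) ->
  (forall x r, states M x -> closed [set a | act M x a /\ g x a <= r]) ->
  (forall x, states M x -> exists b, forall a, act M x a -> b <= g x a) ->
  exists2 phi, policies M phi &
    forall x a, states M x -> act M x a -> g x (phi x) <= g x a.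
Proof.
move=> mg cg bg; have [BE sE] := separable_sieve sepE.
have [BF sF] := separable_sieve sepF.
have hF : hausdorff_space F by exact: metric_hausdorff.
pose sub r := graph M `&` [set z : E * F | g z.1 z.2 <= r].
have bsub r : borel_set (sub r).
  have := mg (borel_graph M) `]-oo, r]%classic (measurable_itv _).
  by congr borel_set; apply/seteqP; split=> z [Gz]; rewrite /= in_itv.
have ksub r : compact_sections (sub r).
  move=> x; have [Sx|nSx] := pselect (states M x); last first.
    rewrite (_ : [set y | _] = set0); first exact: compact0.
    by apply/seteqP; split=> // y [[]].
  apply: (subclosed_compact _ (compact_act Sx)); last by move=> y [[]].
  have := cg x r Sx; congr closed; apply/seteqP; split=> y.
    by move=> [ay gy]; split.
  by move=> [[]].
(* the minimizers, compared with all levels that are reached over the same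
  state *)
pose G := graph M `&` \bigcap_(r : rat) (sub (ratr r)
  `|` fst @^-1` (~` (fst @` sub (ratr r)))).
have GP x a : states M x -> act M x a ->
    G (x, a) <-> forall a', act M x a' -> g x a <= g x a'.
  move=> Sx ax; split.
    move=> [_ H] a' ax'; rewrite leNgt; apply/negP => ga.
    have [r] := rat_in_itvoo ga; rewrite in_itv /= => /andP[r1 r2].
    have [[_ /= gr]|/=[]] := H r I; first by move: r2; rewrite ltNge gr.
    by exists (x, a') => //; split=> //; exact: ltW.
  move=> H; split=> // r _.
  have [[[x' a'] [[/= Sx' ax'] /= gr] /= xx']|] :=
    pselect ((fst @` sub (ratr r)) x).
    by subst x'; left; split=> //=; apply: le_trans gr; exact: H.
  by right.
have bG : borel_set G.
  apply: borel_setI; first exact: borel_graph.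
  apply: borel_countable_bigcap => r; apply: borel_setU; first exact: bsub.
  apply: borel_fst; apply: borel_setC.
  exact: (borel_proj_compact sE sF hF (bsub _) (ksub _)).
have minx x : states M x -> exists2 a, act M x a & forall a', act M x a' ->
  g x a <= g x a'.
  move=> Sx; have [b gb] := bg x Sx.
  apply: (compact_attains_min (compact_act Sx) (act_neq0 Sx) _ gb) => r.
  exact: cg.
have kG : compact_sections G.
  move=> x; have [Sx|nSx] := pselect (states M x); last first.
    rewrite (_ : [set y | _] = set0); first exact: compact0.
    by apply/seteqP; split=> // y [[]].
  have [a0 ax0 ga0] := minx x Sx.
  apply: (subclosed_compact _ (compact_act Sx)); last by move=> y [[]].
  have := cg x (g x a0) Sx; congr closed; apply/seteqP; split=> y.
    move=> [ay gy]; apply/(GP x y Sx ay) => a' ax'; apply: le_trans gy _;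
      exact: ga0.
  move=> Gy; have [[_ ay] _] := Gy; split=> //.
  exact: (GP x y Sx ay).1 Gy a0 ax0.
have [f [Gf mf]] := borel_uniformization sE sF hF bG kG.
have fG : fst @` G = states M.
  apply/seteqP; split=> [x [z [[Sz _] _] <-]//|x Sx].
  by have [a ax ga] := minx x Sx; exists (x, a) => //; apply/GP.
have Gfx x : states M x -> G (x, f x).
  by rewrite -fG => -[[x' y] Gy /= <-]; exact: Gf Gy.
exists f; last first.
  move=> x a Sx ax; have Gx := Gfx x Sx; have [[_ afx] _] := Gx.
  exact: (GP x (f x) Sx afx).1.
split; last by move=> x Sx; have [[]] := Gfx x Sx.
apply: (@measurability _ _ (borel E) (borel F) (states M) _ (@open F)) => //.
move=> _ [W oW <-].
rewrite (_ : states M `&` f @^-1` W = states M `\` (states M `&` f @^-1` (~`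
  W))).
  apply: borel_setI; first exact: borel_states.
  by apply: borel_setC; rewrite -fG; apply: mf; exact: open_closedC.
apply/seteqP; split=> x.
  by move=> [Sx Wx]; split=> // -[].
by move=> [Sx H]; split=> //; apply: contrapT => nW; apply: H.
Qed.

End selection.
Local Open Scope ereal_scope.

(** * Integration *)

Section setwise.
Import HBNNSimple.

(* Fatou's lemma for a setwise convergent sequence of measures. *)
Lemma setwise_cvg_integral_gt d (T : measurableType d) (R : realType)
    (m_ : nat -> {measure set T -> \bar R}) (m : {measure set T -> \bar R})
    (f : T -> \bar R) (r : R) :
  (forall B, measurable B -> m_ n B @[n --> \oo] --> m B) ->
  (forall x, 0 <= f x) -> r%:E < \int[m]_x f x ->
  \forall n \near \oo, r%:E < \int[m_ n]_x f x.
Proof.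
(* Some simple function below [f] already integrates to more than [r]. Its integral is a finite sum
   over level sets, which setwise convergence handles. *)
move=> mm f0; rewrite ge0_integralTE // => /ereal_sup_gt[_ [h hf <-] rh].
have hcvg : sintegral (m_ n) h @[n --> \oo] --> sintegral m h.
  pose s := finmap.enum_fset (fset_set (range h)).
  have sE (k : {measure set T -> \bar R}) : sintegral k h =
      \sum_(x <- s | x \in s) x%:E * k (h @^-1` [set x]).
    by rewrite sintegralE fsbig_finite //= big_seq.
  rewrite sE (_ : (fun n => _) = (fun n => \sum_(x <- s | x \in s)
    x%:E * m_ n (h @^-1` [set x]))); last exact/funext.
  apply: cvg_nnesum => y ys.
    have : y \in range h by rewrite -(in_fset_set (fimfunP h)).
    rewrite inE => -[x _ <-].
    by apply: nearW => n; rewrite mule_ge0 // lee_fin.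
  apply: cvgeZl => //; apply: mm; exact: measurable_sfunP.
have Um : nbhs (sintegral m h) [set y | r%:E < y].
  by apply: open_nbhs_nbhs; split=> //; exact: open_ereal_gt_ereal.
have rlt : \forall n \near \oo, r%:E < sintegral (m_ n) h := hcvg _ Um.
apply: filterS rlt => n rn; apply: lt_le_trans rn _.
by rewrite ge0_integralTE //; apply: ereal_sup_ubound; exists h.
Qed.

End setwise.

Lemma rateIstates (R : realType) (E F : completeMetricType R)
    (M : borel_mdp E F) x a (B : set E) : states M x -> act M x a ->
  borel_set B -> rate M x a B = rate M x a (B `&` states M).
Proof.
move=> Sx ax bB; have bS := borel_states M.
rewrite (@measureDI _ _ _ (rate M x a) B (states M)) //.
rewrite [X in X + _](_ : _ = 0) ?add0e //.
apply: (@subset_measure0 _ _ _ (rate M x a) _ (~` states M)).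
- exact: measurableD.
- exact: borel_setC.
- by move=> y [].
- exact: rate_states.
Qed.

Lemma borel_fun_integral (R : realType) (E F : completeMetricType R)
    (M : borel_mdp E F) (u : E -> \bar R) :
  (forall y, states M y -> 0 <= u y) -> borel_fun (states M) u ->
  borel_fun (graph M)
    (fun z : E * F => \int[rate M z.1 z.2]_(y in states M) u y).
Proof.
move=> u0 mu.
have bG := borel_graph M; have bS := borel_states M.
(* Off the graph [rate] is unconstrained; the zero measure there gives a kernel on the whole
   product. *)
pose l (z : borel (E * F)%type) : {measure set (borel E) -> \bar R} :=
  if `[< graph M z >] then rate M z.1 z.2 else mzero.
have ml U : measurable (U : set (borel E)) -> measurable_fun setT (l ^~ U).
  move=> mU.
  have -> : l ^~ U = (fun z : borel (E * F)%type =>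
    rate M z.1 z.2 (U `&` states M)) \_ (graph M).
    apply/funext => z; rewrite /l /patch.
    case: asboolP => [Gz|nGz]; last by rewrite memNset.
    rewrite mem_set //; have [Sz az] := Gz.
    exact: rateIstates.
  have bU : borel_set (U `&` states M) by exact: measurableI.
  exact: ((measurable_restrictT _ bG).1 (borel_rate bU (@subIsetr _ _ _))).
have mu' : measurable_fun (setT : set (borel E)) (u \_ (states M)).
  exact: ((measurable_restrictT _ bS).1 mu).
have u'0 z : 0 <= (u \_ (states M)) z.
  by apply: erestrict_ge0.
have H := measurable_fun_integral_kernel ml u'0 mu'.
have HG : borel_fun (graph M) (fun z : E * F => \int[l z]_y (u \_ (states M))
  y).
  exact: (measurable_funS measurableT (@subsetT _ _) H).
apply: (eq_measurable_fun _ _ HG) => z; rewrite inE => Gz.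
rewrite [RHS]integral_mkcond /l; case: asboolP => //.
Qed.

Lemma nbhs_subspace_seq (T : topologicalType) (A : set T) (a_ : nat -> T)
    (a : T) (P : set T) : (forall n, A (a_ n)) -> A a -> a_ @ \oo --> a ->
  nbhs (a : subspace A) P -> \forall n \near \oo, P (a_ n).
Proof.
move=> Aa_ Aa acvg; rewrite /nbhs /= -nbhs_subspace_in // => WP.
have : \forall n \near \oo, A (a_ n) -> P (a_ n) := acvg _ WP.
by apply: filterS => n; exact.
Qed.

Lemma geometric_small (R : realType) (A b e : R) : (0 <= A)%R -> (0 <= b)%R ->
  (b < 1)%R -> (0 < e)%R -> exists n, (A * b ^+ n < e)%R.
Proof.
move=> A0 b0 b1 e0.
have H : (fun n => A * b ^+ n)%R @ \oo --> (0%R : R).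
  rewrite -(mulr0 A); apply: cvgMr; apply: cvg_expr.
  by rewrite ger0_norm.
have [n _ Hn] := cvgr_lt _ H e e0.
by exists n; exact: (Hn n (leqnn n)).
Qed.

Lemma geometric_eq0 (R : realType) (y A b : R) : (0 <= b)%R ->
  (b < 1)%R -> (forall n, (`|y| <= A * b ^+ n)%R) -> y = 0%R.
Proof.
move=> b0 b1 H.
have A0 : (0 <= A)%R by apply: le_trans (normr_ge0 y) _; rewrite -[A]mulr1;
  exact: (H 0%N).
apply/eqP; rewrite -normr_le0 leNgt; apply/negP => y0.
by have [n] := geometric_small A0 b0 b1 y0; rewrite ltNge H.
Qed.

Lemma geometric_cvg (R : realType) (s : nat -> R) (A b : R) : (0 <= b)%R ->
  (b < 1)%R -> (forall n, (`|s n.+1 - s n| <= A * b ^+ n)%R) ->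
  exists l, s @ \oo --> l /\ forall n, (`|l - s n| <= A / (1 - b) * b ^+ n)%R.
Proof.
move=> b0 b1 H.
have A0 : (0 <= A)%R.
  by apply: le_trans (normr_ge0 (s 1%N - s 0%N)%R) _; rewrite -[A]mulr1;
    exact: (H 0%N).
have b1' : (0 < 1 - b)%R by rewrite subr_gt0.
(* The factor [1 - b ^+ k] keeps the exact geometric partial sum, which turns the last estimate of
   the induction into an identity. *)
have Hk k n : (`|s (n + k)%N - s n| <= A / (1 - b) * b ^+ n * (1 - b ^+ k))%R.
  elim: k => [|k IH]; first by rewrite addn0 expr0 !subrr normr0 mulr0.
  rewrite addnS.
  have -> : (s (n + k).+1 - s n = (s (n + k).+1 - s (n + k)%N)
    + (s (n + k)%N - s n))%R by ring.
  apply: le_trans (ler_normD _ _) _; apply: le_trans (lerD (H _) IH) _.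
  rewrite le_eqVlt; apply/orP; left; apply/eqP.
  by rewrite exprD exprS; field; rewrite gt_eqF.
have Hk' k n : (`|s (n + k)%N - s n| <= A / (1 - b) * b ^+ n)%R.
  apply: le_trans (Hk k n) _; rewrite ler_piMr //.
    by rewrite mulr_ge0 ?divr_ge0 ?exprn_ge0 // ltW.
  by rewrite gerBl exprn_ge0.
have scvg : cvg (s @ \oo).
  apply/cauchy_cvgP; apply: cauchy_exP => e e0.
  have [n Hn] := geometric_small (divr_ge0 A0 (ltW b1')) b0 b1 e0.
  exists (s n); exists n => // m /= nm; rewrite -(subnKC nm) /ball /= distrC.
  exact: le_lt_trans (Hk' _ _) Hn.
exists (lim (s @ \oo)); split=> // n.
have Hc : (fun k => `|s k - s n|%R) @ \oo --> (`|lim (s @ \oo) - s n|)%R.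
  by apply: cvg_norm; apply: cvgB => //; exact: cvg_cst.
rewrite -(cvg_lim _ Hc) //; apply: limr_le; first by apply/cvg_ex; eexists;
  exact: Hc.
by exists n => // m /= nm; rewrite -(subnKC nm).
Qed.

Section density.
Context d d' (T : measurableType d) (T' : measurableType d') (R : realType).
Variables (q : {measure set T -> \bar R}) (h : T -> T') (D : set T) (g : T ->
  R).
Hypotheses (mh : measurable_fun setT h) (mD : measurable D).
Hypotheses (mg : measurable_fun D g) (g0 : forall y, D y -> (0 <= g y)%R).

Let mpre B : measurable B -> measurable (h @^-1` B).
Proof. by move=> mB; rewrite -[X in measurable X]setTI; exact: mh. Qed.

(* The image under [h] of the measure with density [g] on [D]. *)
Lemma density_measure_ex : exists nu : {measure set T' -> \bar R},
  forall B, nu B = \int[q]_(y in D `&` h @^-1` B) (g y)%:E.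
Proof.
pose nu0 (B : set T') := \int[q]_(y in D `&` h @^-1` B) (g y)%:E.
have nu00 : nu0 set0 = 0 by rewrite /nu0 preimage_set0 setI0 integral_set0.
have nu0_ge0 B : 0 <= nu0 B.
  by apply: integral_ge0 => y [Dy _]; rewrite lee_fin g0.
have nu0_sig : semi_sigma_additive nu0.
  move=> A mA tA mUA.
  have -> : nu0 (\bigcup_n A n) = \sum_(0 <= n <oo) nu0 (A n).
    rewrite /nu0 preimage_bigcup setI_bigcupr.
    apply: ge0_integral_bigcup.
    - by move=> k; apply: measurableI => //; exact: mpre.
    - apply/measurable_EFinP; apply: measurable_funS mg => //.
      by move=> y [k _ []].
    - by move=> y [k _ [Dy _]]; rewrite lee_fin g0.
    - apply/trivIsetP => i j _ _ ij; move/trivIsetP : tA => /(_ i j I I ij) Aij.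
      rewrite /= setIACA -(preimage_setI h) Aij.
      by rewrite preimage_set0 setI0.
  by apply: is_cvg_ereal_nneg_natsum => n _; exact: nu0_ge0.
pose nm := isMeasure.Build _ _ _ nu0 nu00 nu0_ge0 nu0_sig.
pose nu : {measure set T' -> \bar R} := HB.pack nu0 nm.
by exists nu.
Qed.

Import HBNNSimple.

Lemma integral_density (nu : {measure set T' -> \bar R}) (f : T' -> \bar R) :
  (forall B, measurable B -> nu B = \int[q]_(y in D `&` h @^-1` B) (g y)%:E) ->
  measurable_fun setT f -> (forall x, 0 <= f x) ->
  \int[nu]_x f x = \int[q]_(y in D) (f (h y) * (g y)%:E).
Proof.
move=> nuE mf f0; pose f_ := nnsfun_approx measurableT mf.
have mfh n : measurable_fun D (fun y => (f_ n (h y))%:E * (g y)%:E).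
  apply: emeasurable_funM; apply/measurable_EFinP => //.
  by apply: (measurable_funS measurableT) => //; apply: measurableT_comp.
transitivity (limn (fun n => \int[nu]_x (f_ n x)%:E)).
  rewrite -monotone_convergence //.
  - by apply: eq_integral => x _; apply/esym/cvg_lim => //;
      exact: cvg_nnsfun_approx.
  - by move=> n; exact/measurable_EFinP.
  - by move=> n x _; rewrite lee_fin.
  - by move=> x _ m n mn; rewrite lee_fin; exact/lefP/nd_nnsfun_approx.
have -> : \int[q]_(y in D) (f (h y) * (g y)%:E) =
    limn (fun n => \int[q]_(y in D) ((f_ n (h y))%:E * (g y)%:E)).
  rewrite -monotone_convergence //.
  - apply: eq_integral => y _; apply/esym/cvg_lim => //; apply: cvgeZr => //.
    exact: cvg_nnsfun_approx.
  - by move=> n y Dy; rewrite mule_ge0 // lee_fin // g0.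
  - move=> y Dy m n mn; rewrite lee_wpmul2r ?lee_fin ?g0 //.
    exact/lefP/nd_nnsfun_approx.
congr (limn _); apply/funext => n.
have mk k : measurable (f_ n @^-1` [set k]) by exact: measurable_sfunP.
have m1 k : measurable_fun D (fun y => (\1_(f_ n @^-1` [set k])
  (h y))%:E * (g y)%:E).
  apply: emeasurable_funM; apply/measurable_EFinP => //.
  apply: (measurable_funS measurableT) => //.
  apply: measurableT_comp => //; exact: measurable_indic.
rewrite integralT_nnsfun sintegralE.
transitivity (\sum_(k \in range (f_ n)) \int[q]_(y in D)
    (k%:E * ((\1_(f_ n @^-1` [set k]) (h y))%:E * (g y)%:E))); last first.
  rewrite -ge0_integral_fsum //.
  - apply: eq_integral => y; rewrite inE => Dy.
    rewrite [in RHS]fimfunE -fsumEFin // ge0_mule_fsuml.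
      by apply: eq_fsbigr => k _; rewrite muleA EFinM.
    by move=> k; rewrite nnfun_muleindic_ge0.
  - by move=> k; apply: emeasurable_funM => //; exact: measurable_cst.
  - move=> k y Dy; rewrite muleA; apply: mule_ge0; last by rewrite lee_fin g0.
    by rewrite nnfun_muleindic_ge0.
apply: eq_fsbigr => k; rewrite inE => -[x _ xk].
rewrite ge0_integralZl //; last 2 first.
- by move=> y Dy; rewrite mule_ge0 // lee_fin // g0.
- by rewrite -xk lee_fin.
rewrite nuE // integral_mkcondr; congr (_ * _); apply: eq_integral => y _.
rewrite /patch indicE; have [Ay|nAy] := pselect ((f_ n @^-1` [set k]) (h y)).
  by rewrite !mem_set // mul1e.
by rewrite !memNset // mul0e.
Qed.

End density.

Section isolated_point.
Variable T : ptopologicalType.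

Lemma measurable_Some : measurable_fun setT (Some : borel T -> hv_space T).
Proof.
apply: (@measurability _ _ (borel T) (hv_space T) setT _ (@isolated_open T)) =>
  //.
by move=> _ [B oB <-]; rewrite setTI; exact: borel_open.
Qed.

(** A set is determined by its trace on [T] and by whether it contains [None], and the singleton of
    [None] is measurable because that point is isolated. *)
Lemma hv_measurable (B : set (option T)) : borel_set (Some @^-1` B) ->
  measurable (B : set (hv_space T)).
Proof.
have mN : measurable ([set None] : set (hv_space T)).
  apply: sub_gen_smallest; rewrite /isolated_open /=.
  rewrite (_ : _ @^-1` _ = set0); first exact: open0.
  by apply/seteqP; split.
suff mS : forall A : set T, borel_set A -> measurable (Some @` A :
  set (hv_space T)).
  move=> bB; have -> : B = (Some @` (Some @^-1` B))
    `|` (if `[< B None >] then [set None] else set0).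
    apply/seteqP; split=> [[x|] Bx|[x|]].
    - by left; exists x.
    - by right; case: asboolP.
    - by move=> [[y By [<-]]//|]; case: asboolP.
    - by move=> [[]//|]; case: asboolP.
  apply: measurableU; first exact: mS.
  by case: ifP => _ //; exact: measurable0.
apply: borel_ind => [A oA|A mA|A mA].
- apply: sub_gen_smallest; rewrite /isolated_open /=.
  rewrite (_ : _ @^-1` _ = A) //; apply/seteqP; split=> x;
    first by move=> [y Ay [<-]].
  by move=> Ax; exists x.
- have -> : Some @` (~` A) = ~` (Some @` A `|` [set None]).
    apply/seteqP; split=> [_ [x nAx <-]|[x|]].
    + by move=> [[y Ay [yx]]|//]; apply: nAx; rewrite -yx.
    + by move=> H; exists x => // Ax; apply: H; left; exists x.
    + by move=> H; exfalso; apply: H; right.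
  by apply: measurableC; apply: measurableU.
- by rewrite image_bigcup; exact: bigcupT_measurable.
Qed.

End isolated_point.

(** * Dynamic programming *)

Section dynamic_programming.
Context (R : realType) (E F : completeMetricType R) (M : borel_mdp E F).
Variables (V mu : E -> R) (K cbar beta : R).
Hypotheses (sepE : separable E) (sepF : separable F) (HS : assumption_S M).
Hypothesis V_borel : borel_fun (states M) V.
Hypothesis V_ge1 : forall x, states M x -> (1 <= V x)%R.
Hypothesis K_ge1 : (1 <= K)%R.
Hypothesis cost_le : forall x, states M x ->
  ereal_sup [set (`|cost M x a|%R)%:E | a in act M x] <= (cbar * V x)%:E.
Hypothesis V_continuous : forall x, states M x ->
  (forall a, act M x a ->
     \int[rate M x a]_(y in states M) (V y)%:E < +oo) /\
  {within act M x, continuous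
     (fun a => \int[rate M x a]_(y in states M) (V y)%:E)}.
Hypothesis mu_borel : borel_fun (states M) mu.
Hypothesis mu_V : forall x, states M x -> (V x <= mu x <= K * V x)%R.
Hypothesis mu_ge : forall x a, states M x -> act M x a ->
  (V x)%:E + \int[rate M x a]_(y in states M) (mu y)%:E <= (mu x)%:E.
Hypotheses (beta_ge : ((K - 1) / K <= beta)%R) (beta_lt1 : (beta < 1)%R).

Let bS : borel_set (states M) := borel_states M.

Lemma mu_gt0 x : states M x -> (0 < mu x)%R.
Proof.
move=> Sx; have /andP[Vmu _] := mu_V Sx.
by apply: lt_le_trans Vmu; apply: lt_le_trans (V_ge1 Sx).
Qed.

Let K_gt0 : (0 < K)%R. Proof. exact: lt_le_trans K_ge1. Qed.

Lemma beta_ge0 : (0 <= beta)%R.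
Proof. by apply: le_trans beta_ge; rewrite divr_ge0 // ?subr_ge0 // ltW. Qed.

Lemma cbar_ge x a : states M x -> act M x a -> (`|cost M x a| <= cbar * V x)%R.
Proof.
move=> Sx ax; rewrite -lee_fin; apply: le_trans (cost_le Sx).
by apply: ereal_sup_ubound; exists a.
Qed.

Lemma cbar_ge0 x : states M x -> (0 <= cbar)%R.
Proof.
move=> Sx; have [a ax] := act_neq0 Sx; have := cbar_ge Sx ax.
move=> /(le_trans (normr_ge0 _)); rewrite pmulr_lge0 //.
exact: lt_le_trans (V_ge1 Sx).
Qed.

Lemma cost_le_mu x a : states M x -> act M x a ->
  (`|cost M x a| <= cbar * mu x)%R.
Proof.
move=> Sx ax; apply: le_trans (cbar_ge Sx ax) _.
by rewrite ler_wpM2l ?(cbar_ge0 Sx) //; case/andP: (mu_V Sx).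
Qed.

Lemma integral_mu_le x a : states M x -> act M x a ->
  \int[rate M x a]_(y in states M) (mu y)%:E <= (beta * mu x)%:E.
Proof.
move=> Sx ax; have := mu_ge Sx ax; have /andP[Vmu muK] := mu_V Sx.
have : 0 <= \int[rate M x a]_(y in states M) (mu y)%:E.
  by apply: integral_ge0 => y Sy; rewrite lee_fin ltW ?mu_gt0.
case: (integral _ _ _) => [r| |] //.
rewrite -EFinD !lee_fin => r0 rle.
(* This is the origin of the lower bound on [beta]: [V >= mu / K] gives
   [mu - V <= (K - 1) / K * mu]. *)
have h : (mu x / K <= V x)%R by rewrite ler_pdivrMr // mulrC.
apply: le_trans (_ : (K - 1) / K * mu x <= _)%R; last first.
  by rewrite ler_wpM2r // ltW ?mu_gt0.
have -> : ((K - 1) / K * mu x = mu x - mu x / K)%R.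
  by field; rewrite gt_eqF.
lra.
Qed.

(** The ball of radius [C] in the [mu]-weighted sup norm; values outside [states M] are left
    free. *)
Definition mu_bounded (C : R) (u : E -> R) :=
  borel_fun (states M) u /\ forall x, states M x -> (`|u x| <= C * mu x)%R.

Lemma mu_boundedD C D u w : mu_bounded C u -> mu_bounded D w ->
  mu_bounded (C + D)%R (fun x => u x + w x)%R.
Proof.
move=> [mu_ ub] [mw wb]; split; first exact: measurable_funD.
move=> x Sx; rewrite mulrDl; apply: le_trans (ler_normD _ _) _.
by apply: lerD; [exact: ub|exact: wb].
Qed.

Lemma mu_boundedB C D u w : mu_bounded C u -> mu_bounded D w ->
  mu_bounded (C + D)%R (fun x => u x - w x)%R.
Proof.
move=> [mu_ ub] [mw wb]; split; first exact: measurable_funB.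
move=> x Sx; rewrite mulrDl; apply: le_trans (ler_normB _ _) _.
by apply: lerD; [exact: ub|exact: wb].
Qed.

Lemma mu_boundedZ C D u : mu_bounded C u -> mu_bounded (`|D| * C)%R (fun x =>
  D * u x)%R.
Proof.
move=> [mu_ ub]; split; first by apply: measurable_funM => //;
  exact: measurable_cst.
by move=> x Sx; rewrite normrM -mulrA ler_wpM2l //; exact: ub.
Qed.

Lemma mu_bounded_mu : mu_bounded 1 mu.
Proof. by split=> // x Sx; rewrite mul1r ger0_norm // ltW ?mu_gt0. Qed.

Lemma mu_bounded_V : mu_bounded 1 V.
Proof.
split=> // x Sx; have /andP[Vmu _] := mu_V Sx.
by rewrite mul1r ger0_norm // (le_trans _ (V_ge1 Sx)).
Qed.

Section action.
Variables (x : E) (a : F).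
Hypotheses (Sx : states M x) (ax : act M x a).

Lemma mu_bounded_integrable C u : mu_bounded C u ->
  (rate M x a).-integrable (states M) (EFin \o u).
Proof.
have imu : (rate M x a).-integrable (states M) (EFin \o mu).
  apply/integrableP; split; first exact/measurable_EFinP.
  have -> : \int[rate M x a]_(y in states M) `|(EFin \o mu) y| =
      \int[rate M x a]_(y in states M) (mu y)%:E.
    apply: eq_integral => y; rewrite inE => Sy /=.
    by rewrite ger0_norm // ltW ?mu_gt0.
  by apply: le_lt_trans (integral_mu_le Sx ax) _; rewrite ltry.
have Cimu : (rate M x a).-integrable (states M) (fun y => C%:E * (mu y)%:E).
  exact: (integrableZl bS C imu).
move=> [mu_ ub]; apply: (le_integrable bS _ _ Cimu).
- exact/measurable_EFinP.
- move=> y Sy; rewrite -EFinM /= lee_fin; apply: le_trans (ub y Sy) _.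
  exact: ler_norm.
Qed.

Definition J (u : E -> R) : R := (\int[rate M x a]_(y in states M) u y)%R.

Lemma EFin_J C u : mu_bounded C u ->
  (J u)%:E = \int[rate M x a]_(y in states M) (u y)%:E.
Proof.
move=> ub; rewrite /J /Rintegral fineK //.
exact: integrable_fin_num (mu_bounded_integrable ub).
Qed.

Lemma eq_J u w : (forall y, states M y -> u y = w y) -> J u = J w.
Proof. by move=> uw; apply: eq_Rintegral => y; rewrite inE; exact: uw. Qed.

Lemma le_J C D u w : mu_bounded C u -> mu_bounded D w ->
  (forall y, states M y -> (u y <= w y)%R) -> (J u <= J w)%R.
Proof.
by move=> ub wb uw; apply: le_Rintegral => //; apply: mu_bounded_integrable;
  eassumption.
Qed.

Lemma J_D C D u w : mu_bounded C u -> mu_bounded D w ->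
  J (fun y => u y + w y)%R = (J u + J w)%R.
Proof.
by move=> ub wb; apply: RintegralD => //; apply: mu_bounded_integrable;
  eassumption.
Qed.

Lemma J_B C D u w : mu_bounded C u -> mu_bounded D w ->
  J (fun y => u y - w y)%R = (J u - J w)%R.
Proof.
by move=> ub wb; apply: RintegralB => //; apply: mu_bounded_integrable;
  eassumption.
Qed.

Lemma J_Z C D u : mu_bounded C u -> J (fun y => D * u y)%R = (D * J u)%R.
Proof.
by move=> ub; apply: RintegralZl => //; apply: mu_bounded_integrable;
  eassumption.
Qed.

Lemma J_mu_le : (J mu <= beta * mu x)%R.
Proof.
by rewrite -lee_fin (EFin_J mu_bounded_mu); exact: integral_mu_le.
Qed.

Lemma J_bound C u : mu_bounded C u -> (`|J u| <= C * (beta * mu x))%R.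
Proof.
move=> ub; have C0 : (0 <= C)%R.
  have := ub.2 x Sx; move=> /(le_trans (normr_ge0 _)).
  by rewrite pmulr_lge0 // mu_gt0.
apply: (@le_trans _ _ (J (fun y => C * mu y)%R)); last first.
  by rewrite (J_Z _ mu_bounded_mu) ler_wpM2l // J_mu_le.
have Cb := mu_boundedZ C mu_bounded_mu.
have Nb := mu_boundedZ (-1)%R Cb.
rewrite ler_norml; apply/andP; split.
  have -> : (- J (fun y => C * mu y) = J (fun y => -1 * (C * mu y)))%R.
    by rewrite (J_Z _ Cb) mulN1r.
  apply: (le_J Nb ub) => y Sy; rewrite mulN1r.
  by have := ub.2 y Sy; rewrite ler_norml => /andP[].
apply: (le_J ub Cb) => y Sy.
by have := ub.2 y Sy; rewrite ler_norml => /andP[].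
Qed.

End action.

Definition Bell (u : E -> R) x a : R := (cost M x a + J x a u)%R.

Lemma EFin_Bell C u x a : states M x -> act M x a -> mu_bounded C u ->
  (Bell u x a)%:E = bellman M (EFin \o u) x a.
Proof. by move=> Sx ax ub; rewrite /Bell EFinD (EFin_J Sx ax ub). Qed.

(** [borel_fun_integral] treats nonnegative integrands. Adding [C * mu] makes [u] nonnegative on the
    states, and its integral is subtracted afterwards. *)
Lemma borel_fun_J C u : mu_bounded C u ->
  borel_fun (graph M) (fun z : E * F => J z.1 z.2 u).
Proof.
move=> ub.
have pos D w : mu_bounded D w -> (forall y, states M y -> (0 <= w y)%R) ->
    borel_fun (graph M) (fun z : E * F => J z.1 z.2 w).
  move=> wb w0.
  have H : borel_fun (graph M)
      (fun z : E * F => \int[rate M z.1 z.2]_(y in states M) (w y)%:E).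
    apply: borel_fun_integral => [y Sy|]; first by rewrite lee_fin w0.
    by have [wm _] := wb; exact/measurable_EFinP.
  exact: (measurableT_comp (fine_measurable measurableT) H).
have Cb := mu_boundedZ C mu_bounded_mu.
have pb := mu_boundedD ub Cb.
have m1 := pos _ _ pb; have m2 := pos _ _ mu_bounded_mu.
have H : borel_fun (graph M) (fun z : E * F =>
    (J z.1 z.2 (fun y => u y + C * mu y) - C * J z.1 z.2 mu)%R).
  apply: measurable_funB; last apply: measurable_funM.
  - apply: m1 => y Sy; have := ub.2 y Sy; rewrite ler_norml => /andP[+ _].
    by rewrite -subr_ge0 opprK.
  - exact: measurable_cst.
  - by apply: m2 => y Sy; rewrite ltW ?mu_gt0.
apply: (eq_measurable_fun _ _ H) => z; rewrite inE => -[Sz az].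
by rewrite (J_D Sz az ub Cb) (J_Z Sz az _ mu_bounded_mu) addrK.
Qed.

Lemma borel_fun_Bell C u : mu_bounded C u ->
  borel_fun (graph M) (fun z : E * F => Bell u z.1 z.2).
Proof.
by move=> ub; apply: measurable_funD; [exact: borel_cost|exact: borel_fun_J ub].
Qed.

(** * Lower semicontinuity in the action and greedy policies *)

Let compact_act x : states M x -> compact (act M x).
Proof. by move=> Sx; exact: (HS.1 x Sx).1. Qed.

Lemma closure_cvg_seq (A : set F) a : closure A a ->
  exists a_ : nat -> F, (forall n, A (a_ n)) /\ a_ @ \oo --> a.
Proof.
move=> Aa.
have /choice[a_ Ha] (n : nat) : exists b, A b /\ ball a (n.+1%:R^-1 : R)%R b.
  have n0 : (0 < n.+1%:R^-1 :> R)%R by rewrite invr_gt0.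
  by have [b [Ab ab]] := Aa _ (nbhsx_ballx a _ n0); exists b.
exists a_; split=> [n|]; first exact: (Ha n).1.
apply/cvg_ballP => e e0.
near=> n; apply: (@le_ball _ _ _ (n.+1%:R^-1 : R)%R); last exact: (Ha n).2.
by apply/ltW; near: n; exact: near_infty_natSinv_lt (PosNum e0).
Unshelve. all: by end_near. Qed.

Lemma closed_Bell_level C u x r : states M x -> mu_bounded C u ->
  closed [set a | act M x a /\ (Bell u x a <= r)%R].
Proof.
move=> Sx ub a cl_a.
have ax : act M x a.
  by apply: (act_closed compact_act Sx); apply: closure_subset cl_a => b [].
split=> //; have [a_ [lev acvg]] := closure_cvg_seq cl_a.
have aa n : act M x (a_ n) by exact: (lev n).1.
have [a0 ax0] := act_neq0 Sx.
have C0 : (0 <= C)%R.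
  have := ub.2 x Sx; move=> /(le_trans (normr_ge0 _)).
  by rewrite pmulr_lge0 // mu_gt0.
(* With this choice [C * mu <= D * V], so [f = u + D * V] is nonnegative on the states. *)
pose D := (C * K)%R.
have Vb := mu_boundedZ D mu_bounded_V.
have fb := mu_boundedD ub Vb.
set f := (fun _ => _) in fb.
have f0 y : states M y -> (0 <= f y)%R.
  move=> Sy; rewrite /f; have := ub.2 y Sy; rewrite ler_norml => /andP[h _].
  have /andP[_ muK] := mu_V Sy.
  have : (C * mu y <= D * V y)%R by rewrite /D -mulrA ler_wpM2l.
  lra.
have BellE b : act M x b -> Bell u x b = (cost M x b + J x b f - D * J x b V)%R.
  move=> bx; rewrite /f (J_D Sx bx ub Vb) (J_Z Sx bx _ mu_bounded_V) /Bell;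
    ring.
rewrite leNgt; apply/negP => ra.
(* Three errors of size [e], from the cost, from the integral of [f] and from that of [D * V],
   exactly exhaust the gap above [r]. *)
pose e := ((Bell u x a - r) / 3)%R.
have e0 : (0 < e)%R by rewrite /e divr_gt0 // subr_gt0.
have near_cost : \forall n \near \oo, (cost M x a - e < cost M x (a_ n))%R.
  have [_ lsc] := HS.1 x Sx.
  have [|W Wa HW] := lsc a (cost M x a - e)%R;
    first by rewrite lte_fin ltrBlDr ltrDl.
  by apply: filterS (nbhs_subspace_seq aa ax acvg Wa) => n /HW; rewrite lte_fin.
have near_f : \forall n \near \oo, (J x a f - e < J x (a_ n) f)%R.
  have /= := @setwise_cvg_integral_gt _ _ _ (fun n => rate M x (a_ n))
    (rate M x a)
    ((EFin \o f) \_ (states M)) (J x a f - e)%R.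
  have rJ b : act M x b -> \int[rate M x b]_y ((EFin \o f) \_ (states M))
    y = (J x b f)%:E.
    by move=> bx; rewrite -integral_mkcond (EFin_J Sx bx fb).
  rewrite rJ // => H.
  have : \forall n \near \oo, (J x a f - e)%:E <
      \int[rate M x (a_ n)]_y ((EFin \o f) \_ (states M)) y.
    apply: H; last by rewrite lte_fin ltrBlDr ltrDl.
      move=> B mB; rewrite (rateIstates Sx ax mB).
      under eq_fun do rewrite (rateIstates Sx (aa _) mB).
      apply: (HS.2 x Sx) => //; exact: measurableI.
    by move=> y; apply: erestrict_ge0 => z Sz; rewrite lee_fin f0.
  by apply: filterS => n; rewrite rJ // lte_fin.
have near_V : \forall n \near \oo, (D * J x (a_ n) V < D * J x a V + e)%R.
  have [_ cV] := V_continuous Sx.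
  have VE b : act M x b -> \int[rate M x b]_(y in states M)
    (V y)%:E = (J x b V)%:E.
    by move=> bx; rewrite (EFin_J Sx bx mu_bounded_V).
  have Jcvg : (fun n => (J x (a_ n) V)) @ \oo --> J x a V.
    apply: (@fine_cvg _ _ _ _ (fun n => (J x (a_ n) V)%:E)).
    rewrite -(VE a ax) => U /cV Ua.
    have : \forall n \near \oo, U (\int[rate M x (a_ n)]_(y in states M)
      (V y)%:E).
      exact: nbhs_subspace_seq aa ax acvg Ua.
    by apply: filterS => n; rewrite /= VE.
  have DJcvg : (fun n => D * J x (a_ n) V)%R @ \oo --> (D * J x a V)%R.
    exact: cvgMr.
  by apply: (cvgr_lt _ DJcvg); rewrite ltrDl.
have : \forall n \near \oo, False.
  near=> n.
  have h1 : (cost M x a - e < cost M x (a_ n))%R by near: n.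
  have h2 : (J x a f - e < J x (a_ n) f)%R by near: n.
  have h3 : (D * J x (a_ n) V < D * J x a V + e)%R by near: n.
  have := (lev n).2; rewrite BellE // => h4.
  have : (3 * e = Bell u x a - r)%R by rewrite /e mulrC divfK.
  rewrite BellE // => h5; lra.
by move=> [n _ /(_ n (leqnn n))].
Unshelve. all: by end_near. Qed.

Lemma greedy_policy C u : mu_bounded C u -> exists2 phi, policies M phi &
  forall x a, states M x -> act M x a -> (Bell u x (phi x) <= Bell u x a)%R.
Proof.
move=> ub; apply: (measurable_minimizer sepE sepF compact_act).
- exact: borel_fun_Bell ub.
- by move=> x r Sx; exact: closed_Bell_level ub.
- move=> x Sx; exists (- (cbar * mu x) - C * (beta * mu x))%R => a ax.
  have := cost_le_mu Sx ax; have := J_bound Sx ax ub.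
  rewrite !ler_norml => /andP[h1 _] /andP[h2 _]; rewrite /Bell; lra.
Qed.

Lemma mu_bounded_Bell C u phi : policies M phi -> mu_bounded C u ->
  mu_bounded (cbar + C * beta)%R (fun x => Bell u x (phi x)).
Proof.
move=> pphi ub; split.
  exact: (borel_fun_policy sepE sepF (borel_fun_Bell ub) pphi).
move=> x Sx; have ax := pphi.2 x Sx; apply: le_trans (ler_normD _ _) _.
by rewrite mulrDl -mulrA lerD ?cost_le_mu // J_bound.
Qed.

Lemma Bell_contraction B C D u w x a : states M x -> act M x a ->
  mu_bounded B u -> mu_bounded C w ->
  (forall y, states M y -> (`|u y - w y| <= D * mu y)%R) ->
  (`|Bell u x a - Bell w x a| <= D * beta * mu x)%R.
Proof.
move=> Sx ax ub wb uw.
have -> : (Bell u x a - Bell w x a = J x a (fun y => u y - w y))%R.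
  by rewrite (J_B Sx ax ub wb) /Bell; ring.
rewrite -mulrA; apply: (J_bound Sx ax); split=> //.
by have [] := mu_boundedB ub wb.
Qed.

(** * Fixed point of the dynamic programming operator *)

Definition min_equation (w : E -> R) := forall x, states M x ->
  (exists2 a, act M x a & w x = Bell w x a) /\
  forall a, act M x a -> (w x <= Bell w x a)%R.

Lemma min_equation_ex : exists C w, mu_bounded C w /\ min_equation w.
Proof.
have /choice[g Hg] (u : E -> R) : exists phi, (exists C, mu_bounded C u) ->
    policies M phi /\ forall x a, states M x -> act M x a ->
      (Bell u x (phi x) <= Bell u x a)%R.
  have [[C ub]|n] := pselect (exists C, mu_bounded C u).
    by have [phi] := greedy_policy ub; exists phi.
  by exists (fun=> point).
(* With a greedy policy chosen for each [u], [T u] is the minimum over the actions, and it is Borel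
   because it is evaluated along a Borel policy. *)
pose T u x := Bell u x (g u x).
have Tb C u : mu_bounded C u -> mu_bounded (cbar + C * beta)%R (T u).
  move=> ub; have [|pu _] := Hg u; first by exists C.
  exact: mu_bounded_Bell.
(* [T u x] is at most [Bell u] at the minimizing action for [w], which is close to [T w x]; the
   other direction is symmetric. *)
have T_contraction B C D u w : mu_bounded B u -> mu_bounded C w ->
    (forall y, states M y -> (`|u y - w y| <= D * mu y)%R) ->
    forall x, states M x -> (`|T u x - T w x| <= D * beta * mu x)%R.
  move=> ub wb uw x Sx.
  have [pu mu_] : policies M (g u) /\ forall a, act M x a ->
    (T u x <= Bell u x a)%R.
    by have [|pu H] := Hg u; [exists B|split=> // a; exact: H].
  have [pw mw] : policies M (g w) /\ forall a, act M x a ->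
    (T w x <= Bell w x a)%R.
    by have [|pw H] := Hg w; [exists C|split=> // a; exact: H].
  have au := pu.2 x Sx; have aw := pw.2 x Sx.
  have := Bell_contraction Sx au ub wb uw; have := mw _ au.
  have := Bell_contraction Sx aw ub wb uw; have := mu_ _ aw.
  rewrite /T !ler_norml => h1 /andP[h2 h3] h4 /andP[h5 h6]; apply/andP; split;
    lra.
pose u_ n := iter n T (fun=> 0%R).
have u_b n : exists C, mu_bounded C (u_ n).
  elim: n => [|n [C ub]]; last by exists (cbar + C * beta)%R; exact: Tb.
  exists 0%R; split; first exact: measurable_cst.
  by move=> x Sx; rewrite normr0 mul0r.
have ustep n x : states M x ->
  (`|u_ n.+1 x - u_ n x| <= cbar * beta ^+ n * mu x)%R.
  elim: n x => [|n IH] x Sx.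
    have z0 : mu_bounded 0 (u_ 0%N).
      split; first exact: measurable_cst.
      by move=> y Sy; rewrite normr0 mul0r.
    rewrite subr0 expr0 mulr1; have [_ /(_ x Sx)] := Tb _ _ z0.
    by rewrite mul0r addr0.
  have [B Bb] := u_b n.+1; have [C Cb] := u_b n.
  by rewrite exprSr mulrA; apply: (T_contraction _ _ _ _ _ Bb Cb).
have /choice[w Hw] x : exists l, states M x -> (u_ n x @[n --> \oo] --> l) /\
    forall n, (`|l - u_ n x| <= cbar / (1 - beta) * beta ^+ n * mu x)%R.
  have [Sx|nSx] := pselect (states M x); last by exists 0%R.
  have [|l [ul lb]] := @geometric_cvg R (u_ ^~ x)
    (cbar * mu x)%R beta beta_ge0 beta_lt1.
    by move=> n; apply: le_trans (ustep n x Sx) _; rewrite mulrAC.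
  exists l => _; split=> // n; apply: le_trans (lb n) _.
  by rewrite le_eqVlt; apply/orP; left; apply/eqP; ring.
have wb : mu_bounded (cbar / (1 - beta))%R w.
  split; last first.
    move=> x Sx; have := (Hw x Sx).2 0%N.
    by rewrite /= subr0 expr0 mulr1.
  have mu_n n : measurable_fun (states M : set (borel E)) (u_ n : borel E -> R).
    by have [C []] := u_b n.
  apply: (measurable_fun_cvg mu_n) => x Sx; exact: (Hw x Sx).1.
have [|pw mw] := Hg w; first by eexists; exact: wb.
have wE x : states M x -> w x = T w x.
  move=> Sx; apply/eqP; rewrite -subr_eq0; apply/eqP.
  (* For every [n], both [w] and [T w] are within a fixed multiple of [beta ^+ n * mu] of the
     iterate [u_ n.+1]. *)
  apply: (@geometric_eq0 _ _ (2 * (cbar / (1 - beta))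
    * mu x)%R beta beta_ge0 beta_lt1) => n.
  have [C Cb] := u_b n.
  have h1 : (`|T w x - u_ n.+1 x| <= cbar / (1 - beta) * beta ^+ n.+1 * mu x)%R.
    rewrite exprSr mulrA; apply: (T_contraction _ _ _ _ _ wb Cb) => // y Sy.
    exact: (Hw y Sy).2.
  have h2 := (Hw x Sx).2 n.+1.
  have h3 : (cbar / (1 - beta) * beta ^+ n.+1 * mu x <= cbar / (1 - beta)
    * beta ^+ n * mu x)%R.
    apply: ler_wpM2r; first by rewrite ltW ?mu_gt0.
    apply: ler_wpM2l.
    - by rewrite divr_ge0 ?(cbar_ge0 Sx) // subr_ge0 ltW.
    - by rewrite exprSr ler_piMr ?exprn_ge0 ?beta_ge0 // ltW.
  have -> : (w x - T w x = (w x - u_ n.+1 x) - (T w x - u_ n.+1 x))%R by ring.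
  apply: le_trans (ler_normB _ _) _; apply: le_trans (lerD h2 h1) _.
  have -> : (2 * (cbar / (1 - beta)) * mu x * beta ^+ n =
    2 * (cbar / (1 - beta) * beta ^+ n * mu x))%R by ring.
  lra.
exists (cbar / (1 - beta))%R, w; split=> // x Sx; split.
  by exists (g w x); [exact: pw.2|exact: wE].
by move=> a ax; rewrite {1}wE //; exact: mw.
Qed.

(** * Evaluation of a fixed policy *)

Section policy.
Variables (phi : E -> F).
Hypothesis pphi : policies M phi.

Let aphi x : states M x -> act M x (phi x). Proof. exact: pphi.2. Qed.

Definition stage_cost n : E -> R :=
  iter n (fun u x => J x (phi x) u) (fun x => cost M x (phi x)).

Definition eval_iter n (w : E -> R) := iter n (fun u x => Bell u x (phi x)) w.

(** Each application of the transition operator gains a factor [beta]. The cost series is thus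
    dominated by a geometric one, and for [beta = 0] all stages but the first vanish on the
    states. *)
Lemma mu_bounded_stage_cost n : mu_bounded (cbar * beta ^+ n)%R (stage_cost n).
Proof.
elim: n => [|n IH].
  split; last by move=> x Sx; rewrite expr0 mulr1 cost_le_mu //; exact: aphi.
  exact: (borel_fun_policy (g := cost M) sepE sepF (@borel_cost _ _ _ M) pphi).
split.
  exact: (borel_fun_policy (g := fun x a => J x a _) sepE sepF (borel_fun_J IH)
    pphi).
move=> x Sx; rewrite exprSr mulrA -[X in (_ <= X)%R]mulrA.
exact: (J_bound Sx (aphi Sx) IH).
Qed.

Lemma stage_costE n x : states M x ->
  iter n (Qop M phi) (fun y => (cost M y (phi y))%:E) x = (stage_cost n x)%:E.
Proof.
elim: n x => [|n IH] x Sx //=.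
rewrite (EFin_J Sx (aphi Sx) (mu_bounded_stage_cost n)).
by apply: eq_integral => y; rewrite inE; exact: IH.
Qed.

Lemma mu_bounded_eval_iter C w n : mu_bounded C w ->
  exists D, mu_bounded D (eval_iter n w).
Proof.
move=> wb; elim: n => [|n [D H]]; first by exists C.
by exists (cbar + D * beta)%R; exact: mu_bounded_Bell.
Qed.

Lemma mu_bounded0 : mu_bounded 0 (fun=> 0%R).
Proof.
split; first exact: measurable_cst.
by move=> x Sx; rewrite normr0 mul0r.
Qed.

(** The policy operator is affine with the transition operator as linear part, so its iterates from
    0 are the partial sums of the cost series. *)
Lemma eval_iter0S n x : states M x ->
  (eval_iter n.+1 (fun=> 0) x - eval_iter n (fun=> 0) x = stage_cost n x)%R.
Proof.
elim: n x => [|n IH] x Sx.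
  rewrite /= /Bell subr0 (_ : J x (phi x) (fun=> 0%R) = 0%R) ?addr0 //.
  by apply/eqP; rewrite -normr_le0 (le_trans (J_bound Sx (aphi Sx)
    mu_bounded0)) // mul0r.
have [C Cb] := mu_bounded_eval_iter n.+1 mu_bounded0.
have [D Db] := mu_bounded_eval_iter n mu_bounded0.
transitivity (J x (phi x) (stage_cost n)) => //.
rewrite -(eq_J _ _ IH) (J_B Sx (aphi Sx) Cb Db).
transitivity (Bell (eval_iter n.+1 (fun=> 0%R)) x (phi x) -
  Bell (eval_iter n (fun=> 0%R)) x (phi x))%R => //.
rewrite /Bell; ring.
Qed.

Lemma eval_iter0E n x : states M x ->
  eval_iter n (fun=> 0%R) x = (\sum_(0 <= k < n) stage_cost k x)%R.
Proof.
move=> Sx; elim: n => [|n IH]; first by rewrite big_geq.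
by rewrite big_nat_recr //= -IH -eval_iter0S // addrC subrK.
Qed.

(** Iterates from [w] and from 0 differ by at most [C * beta ^+ n * mu], so the starting function
    does not affect the limit. *)
Lemma eval_iter_cvg C w x : states M x -> mu_bounded C w ->
  exists L : R, [/\ total_cost M phi x = L%:E,
    (\sum_(0 <= k < n) stage_cost k x)%R @[n --> \oo] --> L &
    eval_iter n w x @[n --> \oo] --> L].
Proof.
move=> Sx wb.
have [|L [sL _]] := @geometric_cvg R (fun n => eval_iter n (fun=> 0%R) x)
    (cbar * mu x)%R beta beta_ge0 beta_lt1.
  move=> n; rewrite eval_iter0S // mulrAC.
  by have [_] := mu_bounded_stage_cost n; exact.
have sE : (fun n => \sum_(0 <= k < n) stage_cost k x)%R = (fun n =>
  eval_iter n (fun=> 0%R) x).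
  by apply/funext => n; rewrite eval_iter0E.
exists L; split; last 2 first.
- by rewrite sE.
- have hs n : (`|eval_iter n w x - eval_iter n (fun=> 0)
    x| <= C * beta ^+ n * mu x)%R.
    elim: n x Sx {sL sE} => [|n IH] x Sx.
      by rewrite /= subr0 expr0 mulr1; have [_] := wb; exact.
    have [D Db] := mu_bounded_eval_iter n wb.
    have [D' Db'] := mu_bounded_eval_iter n mu_bounded0.
    by rewrite exprSr mulrA; exact: (Bell_contraction Sx (aphi Sx) Db Db').
  have d0 : (fun n => eval_iter n w x - eval_iter n (fun=> 0) x)%R @ \oo -->
    (0%R : R).
    apply/cvgr0Pnorm_lt => e e0.
    have C0 : (0 <= C * mu x)%R by have [_ /(_ x Sx)] := wb; exact: le_trans.
    have [n Hn] := geometric_small C0 beta_ge0 beta_lt1 e0.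
    exists n => // m /= nm; apply: le_lt_trans (hs m) (le_lt_trans _ Hn).
    rewrite mulrAC ler_wpM2l // ler_wiXn2l ?beta_ge0 //; exact: ltW.
  rewrite -[L]add0r (_ : (fun n => _) = (fun n =>
    (eval_iter n w x - eval_iter n (fun=> 0) x) +
    eval_iter n (fun=> 0) x)%R); last by apply/funext => n; rewrite subrK.
  exact: cvgD.
- rewrite /total_cost; apply: cvg_lim => //.
  rewrite (_ : (fun n => _) = (fun n => (eval_iter n (fun=> 0%R) x)%:E)).
    by apply/fine_cvgP; split; [exact: nearW|exact: sL].
  apply/funext => n; rewrite eval_iter0E // -sumEFin.
  by apply: eq_bigr => k _; exact: stage_costE.
Qed.

Lemma total_cost_fixed C w x : states M x -> mu_bounded C w ->
  (forall y, states M y -> w y = Bell w y (phi y)) ->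
  total_cost M phi x = (w x)%:E.
Proof.
move=> Sx wb wE; have [L [-> _ hL]] := eval_iter_cvg Sx wb.
congr EFin; rewrite -(cvg_lim _ hL) //.
rewrite (_ : (fun n => _) = fun=> w x) ?lim_cst //.
apply/funext; elim=> [//|n IH] /=.
have hn : forall y, states M y -> eval_iter n w y = w y.
  elim: {IH} n => [//|n IH] y Sy.
  by rewrite [RHS]wE // /= /Bell; congr (_ + _)%R; exact: eq_J.
by rewrite [RHS]wE // /Bell; congr (_ + _)%R; exact: eq_J.
Qed.

(* With [T u x := Bell u x (phi x)], monotonicity of [T] and [w <= T w] yield
   [T w <= T^n w], which tends to the total cost. *)
Lemma total_cost_sub C w x : states M x -> mu_bounded C w ->
  (forall y, states M y -> (w y <= Bell w y (phi y))%R) ->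
  (Bell w x (phi x))%:E <= total_cost M phi x.
Proof.
move=> Sx wb wle; have [L [-> _ hL]] := eval_iter_cvg Sx wb; rewrite lee_fin.
have mono n y : states M y -> (eval_iter n w y <= eval_iter n.+1 w y)%R.
  elim: n y => [|n IH] y Sy; first exact: wle.
  have [D Db] := mu_bounded_eval_iter n wb.
  have [D' Db'] := mu_bounded_eval_iter n.+1 wb.
  by rewrite /= /Bell lerD2l; apply: (le_J Sy (aphi Sy) Db Db').
have h1 n : (Bell w x (phi x) <= eval_iter n.+1 w x)%R.
  by elim: n => [//|n IH]; apply: le_trans IH (mono _ _ Sx).
rewrite -(cvg_lim _ hL) //; apply: limr_ge; first by apply/cvg_ex; eexists;
  exact: hL.
by exists 1%N => // -[|n].
Qed.

End policy.

(** Stated for an arbitrary [mu]-bounded solution: for the one from value iteration it identifies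
    the value function, for any other it gives uniqueness. *)
Lemma value_min_equation C w : mu_bounded C w -> min_equation w ->
  (forall x, states M x -> value M x = (w x)%:E) /\
  exists phi, total_cost_optimal M phi.
Proof.
move=> wb wE; have [phi pphi mphi] := greedy_policy wb.
have wphi x : states M x -> w x = Bell w x (phi x).
  move=> Sx; have [[a ax wa] wle] := wE x Sx; apply/le_anti/andP; split.
    by apply: wle; exact: pphi.2.
  by rewrite wa; exact: mphi.
have vE x : states M x -> value M x = (w x)%:E.
  move=> Sx; apply/le_anti/andP; split.
    by apply: ereal_inf_lbound; exists phi => //;
      exact: total_cost_fixed wb wphi.
  apply: le_ereal_inf_tmp => _ [psi ppsi <-].
  apply: le_trans (total_cost_sub ppsi Sx wb _).
    by rewrite lee_fin; apply: (wE x Sx).2; exact: ppsi.2.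
  by move=> y Sy; apply: (wE y Sy).2; exact: ppsi.2.
split=> //; exists phi; split=> // x Sx.
by rewrite vE //; exact: total_cost_fixed wb wphi.
Qed.

Lemma optimal_iff C w phi : mu_bounded C w -> min_equation w ->
  policies M phi ->
  total_cost_optimal M phi <-> forall x, states M x -> w x = Bell w x (phi x).
Proof.
move=> wb wE pphi; have [vE _] := value_min_equation wb wE; split.
  move=> [_ opt] x Sx; apply/le_anti/andP; split.
    by apply: (wE x Sx).2; exact: pphi.2.
  (* Bounding the total cost below by [Bell w], rather than by [w] alone, is what turns optimality
     into equality at [x]. *)
  rewrite -lee_fin -vE // -opt //; apply: (total_cost_sub pphi Sx wb) => y Sy.
  by apply: (wE y Sy).2; exact: pphi.2.
move=> wphi; split=> // x Sx; rewrite vE //; exact: total_cost_fixed wb wphi.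
Qed.

(** * The HV transformation *)

Lemma measurable_hv_states C w (f : option E -> \bar R) : mu_bounded C w ->
  (forall y, states M y -> f (Some y) = ((mu y)^-1 * w y)%:E) ->
  measurable_fun setT (f \_ (hv_states M) : hv_space E -> \bar R).
Proof.
move=> wb fS; set g := f \_ _.
have gS y : states M y -> g (Some y) = ((mu y)^-1 * w y)%:E.
  by move=> Sy; rewrite /g /patch mem_set ?fS //; left; exists y.
move=> _ Y mY; rewrite setTI; apply: hv_measurable.
have -> : Some @^-1` (g @^-1` Y) =
    ((fun y => ((mu y)^-1 * w y)%:E) \_ (states M)) @^-1` Y.
  apply/seteqP; split=> y; rewrite /= /patch;
    (have [Sy|nSy] := pselect (states M y); first by rewrite mem_set // gS);
    rewrite memNset // /g /patch memNset //;
    by move=> [[z Sz [zy]]|//]; apply: nSy; rewrite -zy.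
have mH : borel_fun (states M) (fun y => ((mu y)^-1 * w y)%:E).
  apply/measurable_EFinP; apply: measurable_funM; last exact: wb.1.
  have mpow : borel_fun (states M) (fun y => mu y `^ (-1))%R.
    exact: (measurableT_comp (measurable_powR _) mu_borel).
  apply: (eq_measurable_fun _ _ mpow) => y; rewrite inE => Sy.
  by rewrite powR_inv1 // ltW ?mu_gt0.
by have := (measurable_restrictT _ bS).1 mH measurableT Y mY; rewrite setTI.
Qed.

Section hv_integral.
Variables (x : E) (a : F).
Hypotheses (Sx : states M x) (ax : act M x a).

Lemma inv_beta_mu_ge0 : (0 <= (beta * mu x)^-1)%R.
Proof. by rewrite invr_ge0 mulr_ge0 ?beta_ge0 // ltW ?mu_gt0. Qed.

(** Hence the mass assigned to [None] is nonnegative. *)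
Lemma hv_mass_le1 : ((beta * mu x)^-1 * J x a mu <= 1)%R.
Proof.
have [b0|b0] := eqVneq beta 0%R; first by rewrite b0 mul0r invr0 mul0r ler01.
have bmu : (0 < beta * mu x)%R.
  by rewrite mulr_gt0 ?mu_gt0 // lt_neqAle eq_sym b0 beta_ge0.
by rewrite mulrC ler_pdivrMr // mul1r J_mu_le.
Qed.

(** [hv_kernel] is a bare set function. Exhibiting it as a scaled image of the rate with density
    [mu] plus a point mass at [None] opens it to integration theory; [f None = 0] removes the point
    mass. *)
Lemma hv_kernel_measure :
  exists2 m : {measure set (hv_space E) -> \bar R},
    hv_kernel M mu beta (Some x) (Some a) = m &
    forall f : hv_space E -> \bar R,
      measurable_fun setT f -> (forall y, 0 <= f y) -> f None = 0 ->
      \int[m]_y f y = ((beta * mu x)^-1)%:E *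
        \int[rate M x a]_(y in states M) (f (Some y) * (mu y)%:E).
Proof.
have mu_ge0 y : states M y -> (0 <= mu y)%R by move=> Sy; rewrite ltW ?mu_gt0.
have [nu nuE] := density_measure_ex (rate M x a) (@measurable_Some E)
  bS mu_borel mu_ge0.
have d0 : (0 <= 1 - (beta * mu x)^-1 * J x a mu)%R by rewrite subr_ge0
  hv_mass_le1.
exists (measure_add (mscale (NngNum inv_beta_mu_ge0) nu)
  (mscale (NngNum d0) (\d_(None : hv_space E)))).
  apply/funext => B; apply: etrans (esym (measure_addE _ _ B)).
  congr (_ + _); first by rewrite /= -nuE.
  transitivity ((1 - (beta * mu x)^-1 * J x a mu)%:E * (\1_B None)%:E) => //.
  by rewrite EFinB EFinM (EFin_J Sx ax mu_bounded_mu).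
move=> f mf f0 fN; rewrite ge0_integral_measure_add // !ge0_integral_mscale //.
rewrite integral_dirac // fN !mule0 adde0; congr (_ * _).
by apply: (integral_density (@measurable_Some E) bS mu_borel mu_ge0).
Qed.

Lemma integral_hv_kernel C w (f : option E -> \bar R) : mu_bounded C w ->
  f None = 0 -> (forall y, states M y -> f (Some y) = ((mu y)^-1 * w y)%:E) ->
  \int[hv_kernel M mu beta (Some x) (Some a)]_(y in hv_states M) f y =
  ((beta * mu x)^-1 * J x a w)%:E.
Proof.
move=> wb fN fS.
pose g : hv_space E -> \bar R := f \_ (hv_states M).
have gN : g None = 0 by rewrite /g /patch; case: ifP.
have gS y : states M y -> g (Some y) = ((mu y)^-1 * w y)%:E.
  by move=> Sy; rewrite /g /patch mem_set ?fS //; left; exists y.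
have mg : measurable_fun setT g by exact: measurable_hv_states wb fS.
(* Taking positive parts commutes with the factor [mu y > 0], so the density [mu] cancels the
   division by [mu] on each part of [w] separately. *)
have pos (k : R) r : (0 < k)%R -> maxe (k^-1 * r)%:E 0 * k%:E = maxe r%:E 0.
  move=> k0; rewrite maxeMl ?lee_fin ?ltW // mul0e -EFinM mulrAC mulVf ?mul1r
    //.
  by rewrite gt_eqF.
have [m -> mE] := hv_kernel_measure.
rewrite integral_mkcond -/g integralE !mE //; last 4 first.
- exact: measurable_funeneg.
- by rewrite funenegE gN oppe0 maxxx.
- exact: measurable_funepos.
- by rewrite funeposE gN maxxx.
have -> : \int[rate M x a]_(y in states M) (g^\+ (Some y) * (mu y)%:E) =
    \int[rate M x a]_(y in states M) (EFin \o w)^\+ y.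
  apply: eq_integral => y; rewrite inE => Sy.
  by rewrite !funeposE gS // pos ?mu_gt0.
have -> : \int[rate M x a]_(y in states M) (g^\- (Some y) * (mu y)%:E) =
    \int[rate M x a]_(y in states M) (EFin \o w)^\- y.
  apply: eq_integral => y; rewrite inE => Sy.
  by rewrite !funenegE gS // -EFinN -mulrN pos ?mu_gt0.
have wi := mu_bounded_integrable Sx ax wb.
rewrite EFinM (EFin_J Sx ax wb) [in RHS]integralE.
have /fineK <- := integrable_pos_fin_num bS wi.
have /fineK <- := integrable_neg_fin_num bS wi.
by rewrite -!EFinM -!EFinB mulrBr.
Qed.

End hv_integral.

Lemma hv_Pop_None C w phi (f : option E -> \bar R) : mu_bounded C w ->
  f None = 0 -> (forall y, states M y -> f (Some y) = ((mu y)^-1 * w y)%:E) ->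
  hv_Pop M mu beta phi f None = 0.
Proof.
move=> wb fN fS.
transitivity (\int[\d_(None : hv_space E)]_(y in hv_states M) f y) => //.
rewrite integral_mkcond integral_dirac //;
  last exact: measurable_hv_states wb fS.
by rewrite [X in _ * X](_ : _ = 0) ?mule0 // /patch; case: ifP.
Qed.

Section hv_policy.
Variable phi : E -> F.
Hypothesis pphi : policies M phi.

Let f n := iter n (hv_Pop M mu beta phi)
  (fun y => (hv_cost M mu y (omap phi y))%:E).

(* For [beta = 0] and [0 < n] both sides vanish, since [0^-1 = 0]. *)
Lemma hv_iterE n : f n None = 0 /\ forall x, states M x ->
  f n (Some x) = ((mu x)^-1 * ((beta ^+ n)^-1 * stage_cost phi n x))%:E.
Proof.
elim: n => [|n [fN fS]].
  by split=> // x Sx; rewrite expr0 invr1 mul1r.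
have wb := mu_boundedZ ((beta ^+ n)^-1)%R (mu_bounded_stage_cost pphi n).
split; first exact: (hv_Pop_None phi wb fN fS).
move=> x Sx; have ax := pphi.2 x Sx.
apply: etrans (integral_hv_kernel Sx ax wb fN fS) _.
rewrite (J_Z Sx ax _ (mu_bounded_stage_cost pphi n)) exprSr !invfM; congr EFin.
transitivity ((mu x)^-1 * ((beta ^+ n)^-1 * beta^-1 * J x (phi x)
  (stage_cost phi n)))%R => //.
ring.
Qed.

Lemma hv_stageE n x : states M x ->
  (beta ^+ n)%:E * f n (Some x) = ((mu x)^-1 * stage_cost phi n x)%:E.
Proof.
move=> Sx; rewrite (hv_iterE n).2 // -EFinM; congr EFin.
(* A vanishing power cannot be cancelled, but then the stage cost is itself 0 by its bound
   [cbar * beta ^+ n * mu]. *)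
have [b0|b0] := eqVneq (beta ^+ n)%R 0%R.
  have -> : stage_cost phi n x = 0%R.
    apply/eqP; rewrite -normr_le0;
      have [_ /(_ x Sx)] := mu_bounded_stage_cost pphi n.
    by rewrite b0 mulr0 mul0r.
  by rewrite !mulr0.
by rewrite mulrCA mulVKf.
Qed.

Lemma hv_total_cost_None : hv_total_cost M mu beta phi None = 0.
Proof. by apply: eseries0 => n _ _; rewrite -/(f n) (hv_iterE n).1 mule0. Qed.

Lemma hv_total_costE x : states M x ->
  hv_total_cost M mu beta phi (Some x) = ((mu x)^-1)%:E * total_cost M phi x.
Proof.
move=> Sx; have [L [-> sL _]] := eval_iter_cvg pphi Sx mu_bounded0.
rewrite -EFinM /hv_total_cost; apply: cvg_lim => //.
rewrite (_ : (fun n => _) = (fun n => ((mu x)^-1 * \sum_(0 <= k < n)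
  stage_cost phi k x)%:E)).
  by apply/fine_cvgP; split; [exact: nearW|exact: cvgMr].
apply/funext => n; rewrite mulr_sumr -sumEFin.
by apply: eq_bigr => k _; exact: hv_stageE.
Qed.

End hv_policy.

Lemma hv_value_None : policies M !=set0 -> hv_value M mu beta None = 0.
Proof.
move=> [phi pphi]; apply/le_anti/andP; split.
  by apply: ereal_inf_lbound; exists phi => //; exact: hv_total_cost_None.
by apply: le_ereal_inf_tmp => _ [psi ppsi <-]; rewrite hv_total_cost_None.
Qed.

Lemma hv_valueE x phi : states M x -> total_cost_optimal M phi ->
  hv_value M mu beta (Some x) = ((mu x)^-1)%:E * value M x.
Proof.
move=> Sx [pphi opt]; apply/le_anti/andP; split.
  apply: ereal_inf_lbound; exists phi => //.
  by rewrite hv_total_costE // opt.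
apply: le_ereal_inf_tmp => _ [psi ppsi <-]; rewrite hv_total_costE //.
apply: lee_wpmul2l; first by rewrite lee_fin invr_ge0 ltW ?mu_gt0.
by apply: ereal_inf_lbound; exists psi.
Qed.

Lemma hv_bellmanE C w x a (f : option E -> \bar R) : states M x -> act M x a ->
  mu_bounded C w -> f None = 0 ->
  (forall y, states M y -> f (Some y) = ((mu y)^-1 * w y)%:E) ->
  hv_bellman M mu beta f (Some x) (Some a) = ((mu x)^-1 * Bell w x a)%:E.
Proof.
move=> Sx ax wb fN fS; rewrite /hv_bellman (integral_hv_kernel Sx ax wb fN fS).
rewrite -EFinM -EFinD /= /Bell mulrDr; congr (_ + _)%:E.
have [b0|b0] := eqVneq beta 0%R; last by rewrite invfM -mulrA mulVKf.
have -> : J x a w = 0%R.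
  apply/eqP; rewrite -normr_le0; have := J_bound Sx ax wb.
  by rewrite b0 mul0r mulr0.
by rewrite !mulr0.
Qed.

(** Uniqueness is claimed among extended real functions. The weighted bound excludes infinite values
    on the states, and [V <= mu] turns it into a bound in the [mu] norm. *)
Lemma weighted_bounded_fin (u : E -> \bar R) : borel_fun (states M) u ->
  weighted_bounded M V u -> (forall x, states M x -> u x = (fine (u x))%:E) /\
  exists C, mu_bounded C (fine \o u).
Proof.
move=> mu_; rewrite /weighted_bounded; set s := ereal_sup _ => ub.
have us x : states M x -> ((V x)^-1)%:E * `|u x| <= s.
  by move=> Sx; apply: ereal_sup_ubound; exists x.
have V0 x : states M x -> (0 < V x)%R by move=> /V_ge1; exact: lt_le_trans.
have ufin x : states M x -> u x = (fine (u x))%:E.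
  move=> Sx; have h := le_lt_trans (us x Sx) ub; rewrite fineK // fin_num_abs.
  have [//|] := ltP `|u x| +oo; rewrite leye_eq => /eqP uoo.
  by move: h; rewrite uoo mulry gtr0_sg ?invr_gt0 ?V0 // mul1e ltxx.
split=> //; exists (fine s); split.
  exact: (measurableT_comp (fine_measurable measurableT) mu_).
move=> x Sx /=; have h := us x Sx.
have s0 : 0 <= s.
  by apply: le_trans h; rewrite mule_ge0 // lee_fin invr_ge0 ltW ?V0.
have sE : s = (fine s)%:E by rewrite fineK // ge0_fin_numE.
move: h; rewrite ufin // sE /= -EFinM lee_fin ler_pdivrMl ?V0 // => h.
apply: le_trans h _; rewrite mulrC ler_wpM2l ?fine_ge0 //.
by case/andP: (mu_V Sx).
Qed.

Lemma bellman_fin (u : E -> \bar R) x a : states M x -> act M x a ->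
  (forall y, states M y -> u y = (fine (u y))%:E) ->
  (exists C, mu_bounded C (fine \o u)) ->
  bellman M u x a = (Bell (fine \o u) x a)%:E.
Proof.
move=> Sx ax ufin [C ub]; rewrite (EFin_Bell Sx ax ub); congr (_ + _).
by apply: eq_integral => y; rewrite inE; exact: ufin.
Qed.

Let bellman_value C w x a : mu_bounded C w ->
  (forall y, states M y -> value M y = (w y)%:E) ->
  states M x -> act M x a -> bellman M (value M) x a = (Bell w x a)%:E.
Proof.
move=> wb vE Sx ax; rewrite (EFin_Bell Sx ax wb); congr (_ + _).
by apply: eq_integral => y; rewrite inE; exact: vE.
Qed.

Let optimal_actionsP C w x a : mu_bounded C w ->
  (forall y, states M y -> value M y = (w y)%:E) -> states M x ->
  optimal_actions M x a <-> act M x a /\ w x = Bell w x a.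
Proof.
move=> wb vE Sx; split=> -[ax]; rewrite ?(bellman_value wb vE) ?vE //.
  by move=> [].
by move=> e; split=> //; rewrite (bellman_value wb vE) // vE // -e.
Qed.

Lemma total_cost_optimal_ex : exists phi, total_cost_optimal M phi.
Proof.
have [C [w [wb wE]]] := min_equation_ex.
by have [_] := value_min_equation wb wE.
Qed.

Lemma value_hv_value x : states M x ->
  value M x = (mu x)%:E * hv_value M mu beta (Some x).
Proof.
move=> Sx; have [phi opt] := total_cost_optimal_ex.
have mu0 := mu_gt0 Sx.
by rewrite (hv_valueE Sx opt) muleA -EFinM mulfV ?gt_eqF // mul1e.
Qed.

Lemma borel_value : borel_fun (states M) (value M).
Proof.
have [C [w [wb wE]]] := min_equation_ex.
have [vE _] := value_min_equation wb wE.
have mw : borel_fun (states M) (EFin \o w) by apply/measurable_EFinP;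
  exact: wb.1.
by apply: (eq_measurable_fun _ _ mw) => x; rewrite inE => Sx; rewrite vE.
Qed.

Lemma value_optimality_equation : optimality_equation M (value M).
Proof.
have [C [w [wb wE]]] := min_equation_ex.
have [vE _] := value_min_equation wb wE.
move=> x Sx; have [[a ax wa] wle] := wE x Sx; split.
  by exists a => //; rewrite vE // (bellman_value wb vE) // wa.
by move=> b bx; rewrite vE // (bellman_value wb vE) // lee_fin wle.
Qed.

Lemma value_weighted_bounded : weighted_bounded M V (value M).
Proof.
have [C [w [wb wE]]] := min_equation_ex.
have [vE _] := value_min_equation wb wE.
apply: (@le_lt_trans _ _ (C * K)%:E); last by rewrite ltry.
apply: ge_ereal_sup => _ [x Sx <-]; rewrite vE // -EFinM lee_fin.
have V0 : (0 < V x)%R by exact: lt_le_trans (V_ge1 Sx).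
rewrite ler_pdivrMl //; have [_ /(_ x Sx) wx] := wb.
have C0 : (0 <= C)%R.
  by move: wx => /(le_trans (normr_ge0 _)); rewrite pmulr_lge0 // mu_gt0.
apply: le_trans wx _; have /andP[_ muK] := mu_V Sx.
apply: le_trans (ler_wpM2l C0 muK) _.
by rewrite mulrA [X in (_ <= X)%R]mulrC.
Qed.

Lemma optimality_equation_unique (u : E -> \bar R) :
  borel_fun (states M) u -> optimality_equation M u -> weighted_bounded M V u ->
  forall x, states M x -> u x = value M x.
Proof.
move=> mu_ uopt ub x Sx; have [ufin [D uD]] := weighted_bounded_fin mu_ ub.
have bu y a : states M y -> act M y a -> bellman M u y a = (Bell (fine \o u)
  y a)%:E.
  by move=> Sy ay; apply: bellman_fin => //; exists D.
have umin : min_equation (fine \o u).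
  move=> y Sy; have [[a ay ua] ule] := uopt y Sy; split.
    by exists a => //=; rewrite ua bu.
  by move=> b b_y; rewrite -lee_fin -bu // /= -ufin //; exact: ule.
by have [vE' _] := value_min_equation uD umin; rewrite vE' // ufin.
Qed.

Lemma total_cost_optimalP phi : policies M phi -> total_cost_optimal M phi <->
  forall x, states M x -> optimal_actions M x (phi x).
Proof.
move=> pphi; have [C [w [wb wE]]] := min_equation_ex.
have [vE _] := value_min_equation wb wE.
rewrite (optimal_iff wb wE pphi); split=> H x Sx.
  by apply/(optimal_actionsP _ wb vE Sx); split; [exact: pphi.2|exact: H].
by have /(optimal_actionsP _ wb vE Sx)[] := H x Sx.
Qed.

(** Both sides of the transformed equation are those of the original one divided by the nonzero
    number [mu x]. *)
Lemma optimal_actions_hv x : states M x -> optimal_actions M x =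
  [set a | act M x a /\ hv_value M mu beta (Some x) =
     hv_bellman M mu beta (hv_value M mu beta) (Some x) (Some a)].
Proof.
move=> Sx; have [C [w [wb wE]]] := min_equation_ex.
have [vE [phi opt]] := value_min_equation wb wE.
have hvE y : states M y -> hv_value M mu beta (Some y) = ((mu y)^-1 * w y)%:E.
  by move=> Sy; rewrite (hv_valueE Sy opt) vE.
have hvN : hv_value M mu beta None = 0.
  by apply: hv_value_None; exists phi; exact: opt.1.
apply/seteqP; split=> a.
  move=> /(optimal_actionsP _ wb vE Sx)[ax e]; split=> //.
  by rewrite (hv_bellmanE Sx ax wb hvN hvE) hvE // -e.
move=> [ax e]; apply/(optimal_actionsP _ wb vE Sx); split=> //; move: e.
rewrite (hv_bellmanE Sx ax wb hvN hvE) hvE // => -[/mulfI]; apply.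
by rewrite invr_neq0 // gt_eqF // mu_gt0.
Qed.

End dynamic_programming.

Theorem theorem12 (R : realType) (E F : completeMetricType R)
  (sepE : separable E) (sepF : separable F) (M : borel_mdp E F)
  (HS : assumption_S M)
  (V : E -> R) (K cbar : R)
  (V_borel : borel_fun (states M) V)
  (V_ge1 : forall x, states M x -> (1 <= V x)%R)
  (K_ge1 : (1 <= K)%R)
  (Ha : forall phi, policies M phi -> kernel_norm M V (Qsum M phi) <= K%:E)
  (Hb_cost : forall x, states M x ->
    ereal_sup [set (`|cost M x a|%R)%:E | a in act M x] <= (cbar * V x)%:E)
  (Hb_V : forall x, states M x ->
    (forall a, act M x a ->
       \int[rate M x a]_(y in states M) (V y)%:E < +oo) /\
    {within act M x, continuous
       (fun a => \int[rate M x a]_(y in states M) (V y)%:E)})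
  (mu : E -> R)
  (mu_borel : borel_fun (states M) mu)
  (mu_V : forall x, states M x -> (V x <= mu x <= K * V x)%R)
  (mu_ge : forall x a, states M x -> act M x a ->
    (V x)%:E + \int[rate M x a]_(y in states M) (mu y)%:E <= (mu x)%:E)
  (beta : R) (beta_ge : ((K - 1) / K <= beta)%R) (beta_lt1 : (beta < 1)%R) :
  (* (i) *)
  ((forall x, states M x ->
      value M x = (mu x)%:E * hv_value M mu beta (Some x)) /\
   (borel_fun (states M) (value M) /\ optimality_equation M (value M) /\
    weighted_bounded M V (value M)) /\
   (forall u : E -> \bar R,
      borel_fun (states M) u -> optimality_equation M u ->
      weighted_bounded M V u -> forall x, states M x -> u x = value M x)) /\
  (* (ii) *)
  (exists phi, total_cost_optimal M phi) /\
  (* (iii) *)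
  ((forall phi, policies M phi ->
      (total_cost_optimal M phi <->
       forall x, states M x -> optimal_actions M x (phi x))) /\
   (forall x, states M x ->
      optimal_actions M x =
      [set a | act M x a /\
         hv_value M mu beta (Some x) =
         hv_bellman M mu beta (hv_value M mu beta) (Some x) (Some a)])).
Proof.
split; [split; [|split; [split; [|split]|]]|split; [|split]].
- exact: (value_hv_value sepE sepF HS V_borel V_ge1 K_ge1 Hb_cost Hb_V
    mu_borel mu_V mu_ge beta_ge beta_lt1).
- exact: (borel_value sepE sepF HS V_borel V_ge1 K_ge1 Hb_cost Hb_V
    mu_borel mu_V mu_ge beta_ge beta_lt1).
- exact: (value_optimality_equation sepE sepF HS V_borel V_ge1 K_ge1 Hb_cost Hb_V
    mu_borel mu_V mu_ge beta_ge beta_lt1).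
- exact: (value_weighted_bounded sepE sepF HS V_borel V_ge1 K_ge1 Hb_cost Hb_V
    mu_borel mu_V mu_ge beta_ge beta_lt1).
- exact: (optimality_equation_unique sepE sepF HS V_borel V_ge1 K_ge1 Hb_cost Hb_V
    mu_borel mu_V mu_ge beta_ge beta_lt1).
- exact: (total_cost_optimal_ex sepE sepF HS V_borel V_ge1 K_ge1 Hb_cost Hb_V
    mu_borel mu_V mu_ge beta_ge beta_lt1).
- exact: (total_cost_optimalP sepE sepF HS V_borel V_ge1 K_ge1 Hb_cost Hb_V
    mu_borel mu_V mu_ge beta_ge beta_lt1).
- exact: (optimal_actions_hv sepE sepF HS V_borel V_ge1 K_ge1 Hb_cost Hb_V
    mu_borel mu_V mu_ge beta_ge beta_lt1).
Qed.
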